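(* Assume CH. There is a quasi-open surjective map $\psi:\mathbb{N}^*\rightarrow\mathbb{N}^*$ such that the images of nowhere dense sets under $\psi$ are nowhere dense and for no nonempty clopen $U\subseteq\mathbb{N}^*$ is the restriction $\psi|U$ a bijection onto its image. Therefore, the operator $T_\psi:C(\mathbb{N}^* )\to C(\mathbb{N}^* )$, $T_\psi(f)=f\circ\psi$, is an everywhere present isomorphic embedding of $\ell_\infty/c_0$ into itself, with no fountains and with no funnels, which is nowhere canonizable along a homeomorphism.
   Context: CH is the continuum hypothesis. $\mathbb{N}^*=\beta\mathbb{N}\setminus\mathbb{N}$; for $A\subseteq\mathbb{N}$, $A^*=\overline{A}^{\beta\mathbb{N}}\setminus A$. $\ell_\infty/c_0$ is canonically identified with $C(\mathbb{N}^* )$, whose dual is identified with the Radon measures on $\mathbb{N}^*$; $T^\star$ is the adjoint of $T$. A measure $\mu$ is concentrated on $F$ if $|\mu|(\mathbb{N}^*\setminus F)=0$. A map $\psi$ is quasi-open if it is continuous and the image of every nonempty open set has nonempty interior. An isomorphic embedding is a bounded linear operator that is an isomorphism onto its closed range. $T$ has no fountains if for every nowhere dense $F\subseteq\mathbb{N}^*$ the set $\{y\in\mathbb{N}^*:T^\star(\delta_y)\text{ is nonzero and concentrated on }F\}$ is nowhere dense (it suffices to consider closed $F$). $T$ has no funnels if for every nowhere dense $F\subseteq\mathbb{N}^*$ there is a nowhere dense $G\subseteq\mathbb{N}^*$ such that $T^\star(\delta_y)$ is concentrated on $G$ for all $y\in F$. For infinite $A,B\subseteq\mathbb{N}$, $P_B:C(\mathbb{N}^*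 )\to C(B^* )$ is restriction, $I_A:C(A^* )\to C(\mathbb{N}^* )$ is extension by zero, and $T_{B,A}=P_B\circ T\circ I_A$. $T$ is everywhere present if $P_B\circ T\ne0$ for every infinite $B\subseteq\mathbb{N}$. $T$ is nowhere canonizable along a homeomorphism if there are no infinite $A,B\subseteq\mathbb{N}$, homeomorphism $\phi:B^*\to A^*$ and nonzero real $r$ such that $T_{B,A}(f)=r f\circ\phi$ for all $f\in C(A^* )$. *)

(* Defs.v *)
From HB Require Import structures.
From mathcomp Require Import all_boot all_order all_algebra.
From mathcomp Require Import all_classical all_reals all_analysis.

Set Implicit Arguments.
Unset Strict Implicit.
Unset Printing Implicit Defensive.

Import Order.TTheory GRing.Theory Num.Theory.
Import numFieldNormedType.Exports.

Local Open Scope classical_set_scope.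
Local Open Scope ring_scope.

(** [2 ^ aleph_0 = aleph_1]: no cardinality lies strictly between those of [nat]
    and of its power set. *)
Definition CH : Prop :=
  forall X : set (set nat), countable X \/ (X #= [set: set nat])%card.

Definition nowhere_dense (X : topologicalType) (F : set X) : Prop :=
  (closure F)^° = set0.

Definition quasi_open (X Y : topologicalType) (f : X -> Y) : Prop :=
  continuous f /\
  (forall U : set X, open U -> U !=set0 -> (f @` U)^° !=set0).

Definition homeomorphism (X Y : topologicalType) (f : X -> Y) : Prop :=
  continuous f /\
  exists g : Y -> X, [/\ continuous g, cancel f g & cancel g f].

HB.mixin Record isCompactSpace T & Topological T := {
  compact_space : compact [set: T]
}.

#[short(type="compactSpaceType")]
HB.structure Definition CompactSpace := {T of Topological T & isCompactSpace T}.

(** The Stone-Cech compactification of the discrete space [nat], as the space of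
    ultrafilters with the clopen base [{u | A \in u}]; [inN] is the canonical
    embedding of [nat]. *)
Record betaN := BetaN {
  ultra_of : set_system nat;
  ultra_ofP : UltraFilter ultra_of
}.

HB.instance Definition _ := gen_eqMixin betaN.
HB.instance Definition _ := gen_choiceMixin betaN.

Lemma betaN_eq (u v : betaN) : ultra_of u = ultra_of v -> u = v.
Proof.
case: u v => [u pu] [v pv] /= uv; case: _ / uv pv => pv.
by rewrite (Prop_irrelevance pu pv).
Qed.

Definition betaN_base (A : set nat) : set betaN := [set u | ultra_of u A].

Lemma betaN_base_cover : \bigcup_(A in [set: set nat]) betaN_base A = setT.
Proof.
rewrite -subTset => u _; have := ultra_ofP u => fu.
by exists setT => //; exact: filterT.
Qed.

Lemma betaN_base_join (A B : set nat) (u : betaN) :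
  [set: set nat] A -> [set: set nat] B ->
  betaN_base A u -> betaN_base B u ->
  exists D, [/\ [set: set nat] D, betaN_base D u &
                betaN_base D `<=` betaN_base A `&` betaN_base B].
Proof.
move=> _ _ uA uB; have := ultra_ofP u => fu.
exists (A `&` B); split=> //; first exact: filterI.
by move=> v vAB; have := ultra_ofP v => fv; split; apply: filterS vAB => n [].
Qed.

HB.instance Definition _ := isBaseTopological.Build betaN
  betaN_base_cover betaN_base_join.

Definition inN (n : nat) : betaN := BetaN (principal_filter_ultra n).

Definition Nstar : Type := set_type (~` range inN).

HB.instance Definition _ := Topological.on Nstar.

(** The closure of [A] in [betaN] minus [A] does not meet [range inN] (see
    [closure_inN]), so nothing is lost when it is viewed inside [Nstar]. *)
Definition star (A : set nat) : set Nstar :=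
  [set x | (closure (inN @` A) `\` inN @` A) (set_val x)].

Lemma betaN_base_open A : open (betaN_base A).
Proof.
exists [set A] => //; rewrite predeqE => u; split=> [[_ -> //]|uA].
by exists A.
Qed.

Lemma betaN_baseC A : ~` betaN_base A = betaN_base (~` A).
Proof.
rewrite predeqE => u; have fu := ultra_ofP u; split => /= [nA|nA uA].
  by case: (in_ultra_setVsetC A fu).
by have [n []] := filter_ex (filterI nA uA).
Qed.

Lemma betaN_base_closed A : closed (betaN_base A).
Proof.
by rewrite -[betaN_base A]setCK betaN_baseC; apply/open_closedC/betaN_base_open.
Qed.

Lemma closure_inN A : closure (inN @` A) = betaN_base A.
Proof.
rewrite eqEsubset; split.
  rewrite closureE; apply: smallest_sub; first exact: betaN_base_closed.
  by move=> _ [n An <-]; exact/principal_filterP.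
move=> u uA B; rewrite nbhsE => -[V [[D _ DV] Vu] VB].
move: (Vu); rewrite -DV => -[E DE uE]; have fu := ultra_ofP u.
have [n [An En]] := filter_ex (filterI uA uE).
exists (inN n); split; first by exists n.
by apply: VB; rewrite -DV; exists E => //; exact/principal_filterP.
Qed.

Lemma starE A : star A = [set x | ultra_of (set_val x) A].
Proof.
rewrite predeqE => x; rewrite /star closure_inN /=; split => [[]//|xA].
by split=> // -[n _ nx]; have /set_mem[] := valP x; exists n.
Qed.

Lemma set_val_continuous (X : topologicalType) (A : set X) :
  continuous (set_val : A -> X).
Proof. exact: initial_continuous. Qed.

Lemma star_clopen A : clopen (star A).
Proof.
rewrite starE -[X in clopen X]/((set_val : Nstar -> betaN) @^-1` betaN_base A).
apply: preimage_clopen; last exact: set_val_continuous.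
by split; [exact: betaN_base_open | exact: betaN_base_closed].
Qed.

Lemma inN_open n : open [set inN n].
Proof.
rewrite (_ : [set inN n] = betaN_base [set n]); first exact: betaN_base_open.
rewrite predeqE => u; split=> [->|un]; first exact/principal_filterP.
apply: betaN_eq => /=; have fu := ultra_ofP u.
apply: (@max_filter _ _ (principal_filter_ultra n)).
by move=> A /principal_filterP An; apply: filterS un => _ ->.
Qed.

Lemma betaN_compact : compact [set: betaN].
Proof.
rewrite compact_ultra => F FF _.
pose lim := [set A : set nat | F (betaN_base A)].
have limp : ProperFilter lim.
  apply: Build_ProperFilter_ex.
    move=> A FA; have [u uA] := @filter_ex _ F _ _ FA.
    by have fu := ultra_ofP u; exact: filter_ex uA.
  split.
  - rewrite /lim /= (_ : betaN_base setT = setT); first by exact: filterT.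
    rewrite -subTset => u _; have fu := ultra_ofP u; exact: filterT.
  - move=> A B FA FB; rewrite /lim /=; apply: (@filterS _ F _ _ _ _ (@filterI _ F _ _ _ FA FB)) => u [uA uB].
    by have fu := ultra_ofP u; exact: filterI.
  - move=> A B AB; apply: (@filterS _ F) => u; have fu := ultra_ofP u.
    exact: filterS.
have limu : UltraFilter lim.
  split=> // G GG limG; rewrite eqEsubset; split=> // A GA.
  case: (in_ultra_setVsetC (betaN_base A) FF) => // FnA.
  have GnA : G (~` A) by apply: limG; rewrite /lim /= -betaN_baseC.
  by have [n []] := filter_ex (filterI GA GnA).
exists (BetaN limu); split=> // B; rewrite nbhsE => -[V [[D _ DV] Vu] VB].
move: (Vu); rewrite -DV => -[A DA FA].
by apply: (@filterS _ F _ _ _ _ FA) => v vA; apply: VB; rewrite -DV; exists A.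
Qed.

Lemma Nstar_compact : compact [set: Nstar].
Proof.
have cl : closed (~` range inN).
  rewrite closedC (_ : range inN = \bigcup_n [set inN n]).
    by apply: bigcup_open => n _; exact: inN_open.
  by rewrite predeqE => u; split=> [[n _ <-]|[n _ ->]]; exists n.
have := subclosed_compact cl betaN_compact (@subsetT _ _).
rewrite !compact_ultra => cK F FF _.
have FF' : ProperFilter (set_val @ F) by exact: fmap_proper_filter.
have [G [GG FG]] := ultraFilterLemma FF'.
have [|u [Ku Gu]] := cK G GG.
  apply: FG; apply: (@filterS _ F _ _ _ _ (@filterT _ F _)) => x _ /=.
  exact: set_mem (valP x).
exists (exist _ u (mem_set Ku)); split=> // B.
case=> W [[V oV VW] Wu] WB.
case: (in_ultra_setVsetC B FF) => // FnB; exfalso.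
have GV : G V by apply: Gu; apply: open_nbhs_nbhs; split=> //; rewrite -VW in Wu.
have : G (~` V).
  apply: FG; apply: (@filterS _ F _ _ _ _ FnB) => x nBx Vx; apply: nBx; apply: WB.
  by rewrite -VW.
by move=> GnV; have [v []] := filter_ex (filterI GV GnV).
Qed.

HB.instance Definition _ := isCompactSpace.Build Nstar Nstar_compact.

Lemma Nstar_inhabited : exists x : Nstar, True.
Proof.
have [u [uu fu]] : exists u, UltraFilter u /\
    [set A : set nat | cofinite_set A] `<=` u.
  exact: ultraFilterLemma.
have uN : (~` range inN) (BetaN uu).
  move=> [n _ [nu]].
  have : u (~` [set n]) by apply: fu => /=; rewrite setCK.
  by rewrite -nu => /principal_filterP; exact.
by exists (exist (fun x => x \in ~` range inN) _ (mem_set uN)).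
Qed.

HB.instance Definition _ := isPointed.Build Nstar (projT1 (cid Nstar_inhabited)).

(** [C(K)]; for [K] compact it carries the sup norm below, and for [K = Nstar] it
    is the Banach space identified with [l_infty / c_0]. *)
Definition contfun (K : topologicalType) (R : realType) : Type :=
  continuousType K R.

Section Contfun.
Context (K : topologicalType) (R : realType).
Local Notation C := (contfun K R).

HB.instance Definition _ := Choice.on C.

Definition contfun_fun (f : C) : K -> R := Continuous.sort f.
Coercion contfun_fun : contfun >-> Funclass.

Definition mkcontfun (f : K -> R) (fc : continuous f) : C :=
  (mkcts fc : continuousType K R).

Lemma contfun_continuous (f : C) : continuous f.
Proof. exact: (@cts_fun _ _ (f : continuousType K R)). Qed.

Lemma contfunP (f g : C) : f =1 g -> f = g.
Proof. by move=> fg; apply/continuousEP. Qed.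

Let add_cts (f g : C) : continuous (fun x => f x + g x).
Proof. by move=> x; apply: cvgD; exact: contfun_continuous. Qed.
Let opp_cts (f : C) : continuous (fun x => - f x).
Proof. by move=> x; apply: cvgN; exact: contfun_continuous. Qed.
Let zero_cts : continuous (fun _ : K => 0 : R).
Proof. by move=> x; exact: cvg_cst. Qed.
Let scale_cts (a : R) (f : C) : continuous (fun x => a * f x).
Proof. by move=> x; apply: cvgMr; exact: contfun_continuous. Qed.

Definition contfun_add (f g : C) := mkcontfun (@add_cts f g).
Definition contfun_opp (f : C) := mkcontfun (@opp_cts f).
Definition contfun_zero := mkcontfun zero_cts.
Definition contfun_scale (a : R) (f : C) := mkcontfun (@scale_cts a f).

Let addA : associative contfun_add.
Proof. by move=> f g h; apply: contfunP => x /=; exact: addrA. Qed.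
Let addC : commutative contfun_add.
Proof. by move=> f g; apply: contfunP => x /=; exact: addrC. Qed.
Let add0 : left_id contfun_zero contfun_add.
Proof. by move=> f; apply: contfunP => x /=; exact: add0r. Qed.
Let addN : left_inverse contfun_zero contfun_opp contfun_add.
Proof. by move=> f; apply: contfunP => x /=; exact: addNr. Qed.

HB.instance Definition _ := GRing.isZmodule.Build C addA addC add0 addN.

Let scaleA a b f : contfun_scale a (contfun_scale b f) = contfun_scale (a * b) f.
Proof. by apply: contfunP => x; exact: mulrA. Qed.
Let scale1 : left_id 1 contfun_scale.
Proof. by move=> f; apply: contfunP => x; exact: mul1r. Qed.
Let scaleDr : right_distributive contfun_scale +%R.
Proof. by move=> a f g; apply: contfunP => x; exact: mulrDr. Qed.
Let scaleDl f : {morph contfun_scale^~ f : a b / a + b}.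
Proof. by move=> a b; apply: contfunP => x; exact: mulrDl. Qed.

HB.instance Definition _ :=
  GRing.Zmodule_isLmodule.Build R C scaleA scale1 scaleDr scaleDl.

End Contfun.

Section ContfunNorm.
Context (K : compactSpaceType) (R : realType).
Local Notation C := (contfun K R).

Definition sup_norm (f : C) : R := sup [set `|f x| | x in [set: K]].

Lemma sup_norm_has_ub (f : C) : has_ubound [set `|f x| | x in [set: K]].
Proof.
have /compact_bounded[M [_ fM]] : compact (f @` [set: K]).
  apply: continuous_compact; last exact: compact_space.
  exact/continuous_subspaceT/contfun_continuous.
exists (M + 1) => _ [x _ <-]; apply: fM; first by rewrite ltrDl.
by exists x.
Qed.

Lemma sup_norm_ge (f : C) (x : K) : `|f x| <= sup_norm f.
Proof. by apply: ub_le_sup; [exact: sup_norm_has_ub | exists x]. Qed.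

Lemma sup_norm_ge0 (f : C) : 0 <= sup_norm f.
Proof.
have [[x _]|/forallNP K0] := pselect (exists x : K, True).
  by rewrite (le_trans _ (sup_norm_ge f x)).
rewrite /sup_norm (_ : [set _ | _ in _] = set0) ?sup0//.
by rewrite -subset0 => ? [x _ _]; exact: (K0 x).
Qed.

Lemma sup_norm_le (f : C) (M : R) :
  0 <= M -> (forall x, `|f x| <= M) -> sup_norm f <= M.
Proof.
move=> M0 fM; rewrite /sup_norm; set S := [set _ | _ in _].
have [->|/set0P S0] := eqVneq S set0; first by rewrite sup0.
by apply: ge_sup => // _ [x _ <-].
Qed.

Let normD (f g : C) : sup_norm (f + g) <= sup_norm f + sup_norm g.
Proof.
apply: sup_norm_le => [|x]; first by rewrite addr_ge0 ?sup_norm_ge0.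
by rewrite (le_trans (ler_normD _ _))// lerD ?sup_norm_ge.
Qed.

Let normZ (a : R) (f : C) : sup_norm (a *: f) = `|a| * sup_norm f.
Proof.
have le b g : sup_norm (b *: g) <= `|b| * sup_norm g.
  apply: sup_norm_le => [|x]; first by rewrite mulr_ge0 ?sup_norm_ge0.
  by rewrite [X in `|X|]/(_ * _) normrM ler_wpM2l ?sup_norm_ge.
apply/eqP; rewrite eq_le le/=.
have [->|a0] := eqVneq a 0; first by rewrite normr0 mul0r sup_norm_ge0.
rewrite -ler_pdivlMl ?normr_gt0// -normfV.
by rewrite -[X in sup_norm X <= _]scale1r -(mulVf a0) -scalerA.
Qed.

Let norm0 (f : C) : sup_norm f = 0 -> f = 0.
Proof.
move=> f0; apply: contfunP => x; apply/eqP; rewrite -[_ == _]normr_le0.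
by rewrite -f0 sup_norm_ge.
Qed.

HB.instance Definition _ := Lmodule_isNormed.Build R C normD normZ norm0.

End ContfunNorm.

Definition bounded_operator (R : realType) (V W : normedModType R)
    (T : {linear V -> W}) : Prop :=
  exists M : R, forall v, `|T v| <= M * `|v|.

(** An isomorphism onto the range amounts to a (necessarily linear) inverse [S]
    which is continuous on the range; values of [S] elsewhere are irrelevant. *)
Definition isomorphic_embedding (R : realType) (V W : normedModType R)
    (T : {linear V -> W}) : Prop :=
  [/\ bounded_operator T, closed (range T) &
      exists S : W -> V, cancel T S /\ {within range T, continuous S}].

Section Composition.
Context (R : realType) (K L : topologicalType) (psi : continuousType L K).

Lemma comp_operator_cts (f : contfun K R) : continuous (f \o psi).
Proof.
move=> x; apply: continuous_comp; first exact: cts_fun.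
exact: contfun_continuous.
Qed.

Definition comp_operator (f : contfun K R) : contfun L R :=
  mkcontfun (@comp_operator_cts f).

Lemma comp_operator_linear : linear comp_operator.
Proof. by move=> a f g; exact: contfunP. Qed.

HB.instance Definition _ :=
  GRing.isLinear.Build R (contfun K R) (contfun L R) _
    comp_operator comp_operator_linear.

End Composition.

Section Dual.
Context (R : realType) (K : topologicalType).

Definition delta (y : K) (f : contfun K R) : R^o := f y.

Lemma delta_linear y : linear (delta y).
Proof. by []. Qed.

HB.instance Definition _ y :=
  GRing.isLinear.Build R (contfun K R) R^o _ (delta y) (delta_linear y).

Definition adjoint (L : topologicalType)
    (T : {linear contfun K R -> contfun L R})
    (phi : {linear contfun L R -> R^o}) : {linear contfun K R -> R^o} :=
  phi \o T.

End Dual.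

Notation borel K := (g_sigma_algebraType (@open K)).

Section Radon.
Context (R : realType) (K : ptopologicalType).
Implicit Types nu : {charge set (borel K) -> \bar R}.

(** [nuPN] is any Hahn decomposition of [nu] ([Hahn_decomposition] provides
    one); the variation and the integral below do not depend on its choice. *)
Definition radon nu P N (nuPN : hahn_decomposition nu P N) : Prop :=
  forall A : set (borel K), measurable A ->
    charge_variation nuPN A =
    ereal_sup [set charge_variation nuPN B |
                B in [set B : set (borel K) |
                  [/\ measurable B, compact (B : set K) & B `<=` A]]].

Definition charge_integral nu P N (nuPN : hahn_decomposition nu P N)
    (f : K -> R) : \bar R :=
  (\int[jordan_pos nuPN]_(x in [set: borel K]) (f x)%:E -
   \int[jordan_neg nuPN]_(x in [set: borel K]) (f x)%:E)%E.

(** The Radon measure that the Riesz representation theorem associates with the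
    functional [phi] vanishes outside of [F]; as [F] need not be Borel, this
    means that the complement of [F] is null for the completed variation.
    The representing measure is unique when [K] is compact Hausdorff. *)
Definition concentrated_on (phi : {linear contfun K R -> R^o}) (F : set K) :
    Prop :=
  exists nu P N (nuPN : hahn_decomposition nu P N),
    [/\ radon nuPN,
        forall f : contfun K R, (phi f)%:E = charge_integral nuPN f &
        (charge_variation nuPN).-negligible (~` F : set (borel K))].

End Radon.

Section NstarOperators.
Context (R : realType).
Local Notation C := (contfun Nstar R).

Definition restrict_to (B : set nat) (f : C) : contfun (star B) R :=
  comp_operator (mkcts (@set_val_continuous _ (star B))) f.

Definition zero_ext (A : set nat) (f : star A -> R) (x : Nstar) : R :=
  if insub x is Some y then f y else 0.

Lemma zero_ext_continuous A (f : contfun (star A) R) : continuous (zero_ext f).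
Proof.
have [oA cA] := star_clopen A.
move=> x V; rewrite /zero_ext; case: insubP => [y xA yx | xA] fV.
- have [W [[D oD DW] Wy] WV] : nbhs (y : star A) (f @^-1` V).
    by exact: (@contfun_continuous _ _ f y V fV).
  have DA : nbhs x (D `&` star A).
    apply: open_nbhs_nbhs; split; first exact: openI.
    by split; [rewrite -yx; rewrite -DW in Wy | exact: set_mem].
  apply: filterS DA => z [Dz /mem_set Az] /=.
  by rewrite insubT; apply: WV; rewrite -DW.
- have nA : nbhs x (~` star A).
    apply: open_nbhs_nbhs; split; first exact: closed_openC.
    by move=> /mem_set; exact/negP.
  apply: filterS nA => z nAz /=; rewrite insubN; last by apply/negP => /set_mem.
  exact: nbhs_singleton fV.
Qed.

Definition extend_by_zero (A : set nat) (f : contfun (star A) R) : C :=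
  mkcontfun (@zero_ext_continuous A f).

Implicit Types T : {linear C -> C}.

Definition localization T (B A : set nat) :
    contfun (star A) R -> contfun (star B) R :=
  restrict_to B \o T \o @extend_by_zero A.
Arguments localization T B A f : clear implicits.

Definition everywhere_present T : Prop :=
  forall B : set nat, infinite_set B -> exists f : C, restrict_to B (T f) != 0.

Definition no_fountains T : Prop :=
  forall F : set Nstar, nowhere_dense F ->
    nowhere_dense [set y | (exists f, adjoint T (delta y) f != 0) /\
                           concentrated_on (adjoint T (delta y)) F].

Definition no_funnels T : Prop :=
  forall F : set Nstar, nowhere_dense F ->
    exists2 G : set Nstar, nowhere_dense G &
      forall y, F y -> concentrated_on (adjoint T (delta y)) G.

Definition nowhere_canonizable_along_homeo T : Prop :=
  ~ exists A B : set nat, exists phi : star B -> star A, exists r : R,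
      [/\ infinite_set A, infinite_set B, homeomorphism phi, r != 0 &
          forall f : contfun (star A) R,
            localization T B A f =1 (fun x => r * f (phi x))].

End NstarOperators.

(* Main.v *)
Require Import Defs.
From mathcomp Require Import all_boot all_order all_algebra.
From mathcomp Require Import all_classical all_reals all_analysis.
From mathcomp Require Import measurable_realfun.
From mathcomp Require wochoice.
Set Implicit Arguments.
Unset Strict Implicit.
Unset Printing Implicit Defensive.
Import Order.TTheory GRing.Theory Num.Theory.
Import numFieldNormedType.Exports.
Local Open Scope classical_set_scope.

(** Let [T] be the set of finite binary words, a word being read as the point of
    the Cantor space that it begins and that is zero afterwards.  Call a subset
    of [T] locally clopen if it is clopen in the induced topology, and uniformly
    clopen if it depends on a bounded number of digits only.  A nonempty locally
    clopen set contains a nonempty uniformly clopen one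
    ([uniformly_clopen_dense]), but it also contains a locally clopen set that
    is not the trace on it of any uniformly clopen one
    ([uniformly_clopen_nowhere_full]).  So the inclusion of the second field of
    sets into the first is dense and nowhere onto; by Stone duality it is an
    irreducible surjection that is injective on no nonempty clopen set.

    Both properties survive in sequences of sets modulo finitely many
    coordinates.  Such a reduced power of a field of sets is countably saturated
    ([diagonal_realization]), and it has at most continuum many elements when
    the underlying set is countable; therefore, under the continuum hypothesis,
    a back-and-forth of length omega_1 identifies the reduced powers of any two
    fields of sets on nonempty countable sets ([reduced_power_iso]).  As the
    subsets of the naturals modulo finite are the reduced power of the two-element
    algebra, transporting the inclusion above yields a self-embedding [phi] of
    this algebra which is dense and nowhere onto ([dense_embedding_exists]).

    The required map sends an ultrafilter [x] to [{A | phi A \in x}]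
    ([psi_exists]).  It is onto because [phi] is injective.  Density of [phi]
    says that every nonempty open set contains the full preimage of a nonempty
    open set; this makes the map quasi-open and makes both images and preimages
    of nowhere dense sets nowhere dense.  Since [phi] is nowhere onto, some point
    has two preimages inside any given nonempty clopen set
    ([psi_not_injective]).

    For the operator: composition with a surjection is isometric, and its range
    is closed because a uniform limit of functions [f \o psi] is constant on the
    fibres of [psi].  The adjoint sends the unit mass at [y] to the unit mass at
    [psi y].  Hence if it is concentrated on [F] then [psi y] lies in the closure
    of [F] (no fountains), and it is concentrated on [psi @` F] when [y] is in
    [F] (no funnels).  If a localization were a multiple of composition with a
    homeomorphism, then [psi] would agree with this homeomorphism on a clopen set
    and be injective there. *)

(** * Reduced powers modulo the finite subsets of the naturals *)

Section ReducedPower.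
Context (T : Type).
Implicit Types (E A B : set (nat * T)) (L : set (set T)).

(** A set [E] of pairs stands for the sequence of its slices.  The slicewise
    members of a field of sets [L], taken modulo the ideal [null], are the
    reduced power of [L] by the filter of cofinite sets. *)
Definition slice E n : set T := [set t | E (n, t)].
Definition slicewise L : set (set (nat * T)) := [set E | forall n, L (slice E n)].
Definition null E : Prop := \forall n \near \oo, slice E n = set0.

Lemma nullP E : null E <-> exists N, forall n t, E (n, t) -> n < N.
Proof.
split=> [[N _ EN]|[N EN]]; exists N => //.
- move=> n t Ent; rewrite ltnNge; apply/negP => Nn.
  by have : slice E n t by []; rewrite (EN n Nn).
- move=> n /= Nn; rewrite -subset0 => t /EN; by rewrite ltnNge Nn.
Qed.

Lemma null0 : null set0.
Proof. by apply/nullP; exists 0. Qed.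

Lemma null_sub A B : A `<=` B -> null B -> null A.
Proof. by move=> AB /nullP[N BN]; apply/nullP; exists N => n t /AB /BN. Qed.

Lemma null_setU A B : null (A `|` B) <-> null A /\ null B.
Proof.
split=> [AB|[/nullP[N AN] /nullP[M BM]]].
  by split; apply: null_sub AB => x; [left|right].
apply/nullP; exists (maxn N M) => n t; rewrite leq_max.
by move=> [/AN ->|/BM ->]; rewrite ?orbT.
Qed.

Lemma nullPn E : ~ null E <-> forall N, exists n, N <= n /\ slice E n !=set0.
Proof.
split=> [E0 N|EN /nullP[N E0]].
  apply: contrapT => H; apply: E0; apply/nullP; exists N => n t Ent.
  by rewrite ltnNge; apply/negP => Nn; apply: H; exists n; split => //; exists t.
by have [n [Nn [t /E0]]] := EN N; rewrite ltnNge Nn.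
Qed.

End ReducedPower.

Definition set_field T (L : set (set T)) : Prop :=
  [/\ L setT, forall A, L A -> L (~` A) & forall A B, L A -> L B -> L (A `&` B)].

Lemma set_field0 T (L : set (set T)) : set_field L -> L set0.
Proof. by move=> [LT LC _]; rewrite -setCT; exact: LC. Qed.

Lemma set_fieldU T (L : set (set T)) : set_field L ->
  forall A B, L A -> L B -> L (A `|` B).
Proof.
move=> [LT LC LI] A B LA LB; rewrite -[A `|` B]setCK setCU.
by apply: (LC); apply: LI; apply: LC.
Qed.

Lemma slicewise_field T (L : set (set T)) : set_field L -> set_field (slicewise L).
Proof.
move=> [LT LC LI]; split => [n|A LA n|A B LA LB n]; first exact: LT.
  exact/LC/LA.
exact: LI (LA n) (LB n).
Qed.

Lemma near_forall_lt (Q : nat -> nat -> Prop) k :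
  (forall i, i < k -> \forall n \near \oo, Q i n) ->
  exists M, forall i n, i < k -> M <= n -> Q i n.
Proof.
elim: k => [_|k IH H]; first by exists 0.
have [M MQ] := IH (fun i ik => H i (ltnW ik)).
have [N _ NQ] := H _ (ltnSn k).
exists (maxn M N) => i n; rewrite ltnS leq_eqVlt geq_max.
by move=> /orP[/eqP ->|ik] /andP[Mn Nn]; [exact: NQ|exact: MQ].
Qed.

(** Countable saturation of reduced powers.  Conditions of two kinds are imposed
    on a sequence: [c i] must hold at almost all coordinates and [o i] at
    infinitely many.  If [b k] meets the first [k] conditions of each kind, one
    can follow each [b k] on a finite block of coordinates, starting late enough
    for the conditions [c i] to have become valid and long enough to
    contain witnesses of the conditions [o i].  As each value is that of some
    [b k], membership in a slicewise field is preserved. *)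
Lemma diagonal_realization V (c o : nat -> nat -> V -> Prop) (b : nat -> nat -> V) :
  (forall k i, i < k -> \forall n \near \oo, c i n (b k n)) ->
  (forall k i, i < k -> forall N, exists n, N <= n /\ o i n (b k n)) ->
  exists d : nat -> V, [/\ forall n, exists k, d n = b k n,
    forall i, \forall n \near \oo, c i n (d n) &
    forall i N, exists n, N <= n /\ o i n (d n)].
Proof.
move=> cb ob.
have /choice[M cM] : forall k, exists M, forall i n, i < k -> M <= n ->
    c i n (b k n).
  by move=> k; apply: near_forall_lt (cb k).
have /choice[W oW] : forall p : nat * nat, exists W, forall i, i < p.1 ->
    exists n, p.2 <= n < W /\ o i n (b p.1 n).
  move=> [k N] /=; have /choice[w ow] : forall i, exists n, i < k ->
      N <= n /\ o i n (b k n).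
    move=> i; have [ik|] := ltnP i k; last by exists 0.
    by have [n ?] := ob _ _ ik N; exists n.
  exists (\max_(i < k) w i).+1 => i ik; exists (w i).
  have [-> ?] := ow _ ik; split=> //.
  by rewrite ltnS (leq_bigmax (Ordinal ik)).
(* The block of [b k] starts at [th k] and ends before [th k.+1]. *)
pose nxt k N := maxn N.+1 (maxn (M k.+1) (W (k, N))).
pose th := fix th k := if k is k'.+1 then nxt k' (th k') else 0.
have thS k : th k < th k.+1 by rewrite /= leq_max leqnn.
have th_mono k l : k <= l -> th k <= th l.
  by move=> /subnKC <-; elim: (l - k) => [|j IH];
    rewrite ?addn0 // addnS (leq_trans IH) // ltnW.
have th_block n : exists k, th k <= n < th k.+1.
  elim: n => [|n [k /andP[kn nk]]]; first by exists 0; exact: (thS 0).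
  have [nk'|nk'] := ltnP n.+1 (th k.+1); first by exists k; rewrite nk' ltnW.
  by exists k.+1; rewrite nk' (leq_ltn_trans _ (thS k.+1)) // (leq_trans _ nk').
have [K KP] := choice th_block.
have K_uniq n k : th k <= n < th k.+1 -> K n = k.
  move=> /andP[kn nk]; have /andP[Kn nK] := KP n; apply/eqP.
  rewrite eqn_leq -ltnS -[k <= _]ltnS; apply/andP; split; rewrite ltnNge;
    apply/negP => /th_mono H.
    by move: (leq_trans H Kn); rewrite leqNgt nk.
  by move: (leq_trans H kn); rewrite leqNgt nK.
have K_ge i n : th i <= n -> i <= K n.
  move=> tn; rewrite leqNgt; apply/negP => /th_mono H.
  by have /andP[_] := KP n; rewrite ltnNge (leq_trans H tn).
exists (fun n => b (K n) n); split=> [n|i|i N]; first by exists (K n).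
- exists (th i.+1) => // n /= tn; have iK := K_ge i.+1 n tn.
  apply: cM => //; have /andP[+ _] := KP n; case: (K n) iK => // k _.
  by apply: leq_trans; rewrite /= !leq_max leqnn orbT.
- pose k := maxn N i.+1; have ik : i < k by rewrite leq_max leqnn orbT.
  have th_ge j : j <= th j by elim: j => // j IH; exact: leq_ltn_trans (thS j).
  have [n [/= /andP[tn nW] on]] := oW (k, th k) i ik.
  exists n; split.
    by rewrite (leq_trans _ tn) // (leq_trans _ (th_ge k)) // leq_max leqnn.
  rewrite (@K_uniq n k) // tn (leq_trans nW) //= !leq_max leqnn ?orbT //.
Qed.

(** Reduced powers have no atoms, even if [L] has: an element that is not null
    is split by keeping every other one of infinitely many coordinates where it
    does not vanish. *)
Lemma null_split T (L : set (set T)) (e : set (nat * T)) : set_field L ->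
  ~ null e -> exists b, [/\ slicewise L b, ~ null (e `&` b) & ~ null (e `\` b)].
Proof.
move=> LF /nullPn en; have /choice[w wP] := en.
pose s := fix s k := if k is k'.+1 then w (s k').+1 else w 0.
have sS k : s k < s k.+1 by have [] := wP (s k).+1.
have se k : slice e (s k) !=set0.
  by case: k => [|k] /=; [have [] := wP 0 | have [] := wP (s k).+1].
have s_ge k : k <= s k by elim: k => // k IH; exact: leq_ltn_trans (sS k).
have sm k l : k < l -> s k < s l.
  move=> /subnKC <-; elim: (l - k.+1) => [|j IH]; rewrite ?addn0 //.
  by rewrite addnS (ltn_trans IH).
have s_inj k l : s k = s l -> k = l.
  by case: (ltngtP k l) => // /sm /[swap] ->; rewrite ltnn.
exists [set p | exists k, p.1 = s k.*2]; split.
- move=> n; have [[k nk]|nk] := pselect (exists k, n = s k.*2).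
    rewrite (_ : slice _ n = setT); first by case: LF.
    by rewrite -subTset => t _; exists k.
  rewrite (_ : slice _ n = set0); first exact: set_field0.
  by rewrite -subset0 => t [k]; apply: contra_not nk; exists k.
- apply/nullPn => N; exists (s N.*2); split.
    by rewrite (leq_trans _ (s_ge _)) // -addnn leq_addr.
  by have [t et] := se N.*2; exists t; split => //; exists N.
- apply/nullPn => N; exists (s N.*2.+1); split.
    by rewrite (leq_trans _ (s_ge _)) // ltnW // ltnS -addnn leq_addr.
  have [t et] := se N.*2.+1; exists t; split => // -[k] /s_inj /(congr1 odd).
  by rewrite /= !odd_double.
Qed.

Section PartialIso.
Context (T U : Type).
Implicit Types (L : set (set T)) (M : set (set U)).
Implicit Types (R : set (set (nat * T) * set (nat * U))).

(** The graph of an isomorphism between subalgebras of the two reduced powers,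
    encoded as a subalgebra [R] of the product: a homomorphism is injective and
    well defined exactly when null elements correspond to null elements.  In this
    form the union of a chain of partial isomorphisms is one. *)
Record partial_iso L M R : Prop := PartialIso {
  pisoL : forall a b, R (a, b) -> slicewise L a;
  pisoM : forall a b, R (a, b) -> slicewise M b;
  pisoT : R (setT, setT);
  pisoC : forall a b, R (a, b) -> R (~` a, ~` b);
  pisoI : forall a b a' b', R (a, b) -> R (a', b') -> R (a `&` a', b `&` b');
  piso_null : forall a b, R (a, b) -> (null a <-> null b) }.

Lemma pisoD L M R a b a' b' : partial_iso L M R ->
  R (a, b) -> R (a', b') -> R (a `\` a', b `\` b').
Proof.
move=> Riso Rab Rab'; rewrite !setDE.
exact: (pisoI Riso) Rab (pisoC Riso Rab').
Qed.

End PartialIso.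

Lemma null_setID T (d p : set (nat * T)) :
  null d <-> null (d `&` p) /\ null (d `\` p).
Proof. by rewrite -null_setU setDE -setIUr setUCr setIT. Qed.

Section Extension.
Context (T U : Type) (L : set (set T)) (M : set (set U)).
Hypotheses (LF : set_field L) (MF : set_field M).
Variables (R : set (set (nat * T) * set (nat * U))).
Hypothesis Riso : partial_iso L M R.
Variable a : set (nat * T).
Hypothesis La : slicewise L a.

(** If [p] is a pair of corresponding elements, adding the pair [(a, b)] to the
    isomorphism forces the parts of [p] inside and outside the cuts [a] and [b]
    to be null simultaneously. *)
Definition cuts_alike b (p : set (nat * T) * set (nat * U)) : Prop :=
  (null (p.1 `&` a) <-> null (p.2 `&` b)) /\
  (null (p.1 `\` a) <-> null (p.2 `\` b)).

(** Finitely many of the conditions on the image [b] of [a] can be met together.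
    The induction cuts the region [p] along the last pair of the list, solves
    both halves and glues the solutions; on a region that is cut no further one
    takes nothing, everything, or a proper part of it. *)
Lemma cuts_alike_exists (l : nat -> set (nat * T) * set (nat * U)) k p :
  (forall i, R (l i)) -> R p ->
  exists2 b, slicewise M b & cuts_alike b p /\
    forall i, i < k -> cuts_alike b (p.1 `&` (l i).1, p.2 `&` (l i).2).
Proof.
move=> Rl; elim: k p => [|k IH] [d e] Rde.
  have /= de := piso_null Riso Rde; rewrite (null_setID d a) in de.
  have SM := slicewise_field MF.
  have [da|da] := pselect (null (d `&` a)).
    exists set0; first exact: set_field0.
    by split => //; split => /=; rewrite ?setI0 ?setD0; have := null0 U; tauto.
  have [da'|da'] := pselect (null (d `\` a)).
    exists setT; first by case: SM.
    by split => //; split => /=; rewrite ?setIT ?setDT; have := null0 U; tauto.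
  have [|b [Mb eb eb']] := @null_split U M e MF; first by tauto.
  by exists b => //; split => //; split => /=; tauto.
have [b1 Mb1 [b1p b1l]] := IH (d `&` (l k).1, e `&` (l k).2)
   ltac:(by apply: (pisoI Riso) => //; rewrite -surjective_pairing).
have [b2 Mb2 [b2p b2l]] := IH (d `\` (l k).1, e `\` (l k).2)
   ltac:(by apply: (pisoD Riso) => //; rewrite -surjective_pairing).
set q := (l k).2 in b1p b1l b2p b2l *; set p := (l k).1 in b1p b1l b2p b2l *.
exists (q `&` b1 `|` b2 `\` q).
  apply: (set_fieldU (slicewise_field MF)).
    have [_ _] := slicewise_field MF; apply => //.
    by apply: (pisoM Riso (a := p)); rewrite -surjective_pairing.
  rewrite setDE; have [_ MC MI] := slicewise_field MF; apply: (MI) => //; apply: (MC).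
  by apply: (pisoM Riso (a := p)); rewrite -surjective_pairing.
have glue x y : cuts_alike b1 (x `&` p, y `&` q) ->
    cuts_alike b2 (x `\` p, y `\` q) ->
    cuts_alike (q `&` b1 `|` b2 `\` q) (x, y).
  move=> [/= c1 c1'] [/= c2 c2']; split => /=.
    rewrite (null_setID (x `&` a) p) (null_setID (y `&` _) q).
    have -> : y `&` (q `&` b1 `|` b2 `\` q) `&` q = y `&` q `&` b1.
      by apply/seteqP; split => z /=; tauto.
    have -> : y `&` (q `&` b1 `|` b2 `\` q) `\` q = (y `\` q) `&` b2.
      by apply/seteqP; split => z /=; tauto.
    have -> : x `&` a `\` p = (x `\` p) `&` a.
      by apply/seteqP; split => z /=; tauto.
    by rewrite setIAC c1 c2.
  rewrite (null_setID (x `\` a) p) (null_setID (y `\` _) q).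
  have -> : (y `\` (q `&` b1 `|` b2 `\` q)) `&` q = (y `&` q) `\` b1.
    by apply/seteqP; split => z /=; tauto.
  have -> : (y `\` (q `&` b1 `|` b2 `\` q)) `\` q = (y `\` q) `\` b2.
    by apply/seteqP; split => z /=; tauto.
  have -> : (x `\` a) `&` p = (x `&` p) `\` a.
    by apply/seteqP; split => z /=; tauto.
  have -> : (x `\` a) `\` p = (x `\` p) `\` a.
    by apply/seteqP; split => z /=; tauto.
  by rewrite c1' c2'.
split; first exact: glue.
move=> i; rewrite ltnS leq_eqVlt => /orP[/eqP ->|ik].
  apply: glue; rewrite -/p -/q.
    by rewrite -!setIA !setIid.
  rewrite !setDE -!setIA !setICr !setI0 /cuts_alike /= !set0I !set0D.
  by have := null0 T; have := null0 U; tauto.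
apply: glue.
  by rewrite -!setIA [_ `&` p]setIC [_ `&` q]setIC !setIA; exact: b1l.
rewrite !setDE -!setIA [_ `&` ~` p]setIC [_ `&` ~` q]setIC !setIA -!setDE.
exact: b2l.
Qed.

Lemma cuts_alike_all : countable R ->
  exists2 b, slicewise M b & forall p, R p -> cuts_alike b p.
Proof.
move=> /pfcard_geP[R0|[l]].
  by have := pisoT Riso; rewrite R0.
have Rl i : R (l i) by exact: funS.
have Rsurj p : R p -> exists i, l i = p.
  by move=> /(@surj _ _ _ _ l)[i _ <-]; exists i.
have /choice[B HB] : forall k, exists b, slicewise M b /\
    forall i, i < k -> cuts_alike b (l i).
  move=> k; have [b Mb [_ bl]] := cuts_alike_exists k Rl (pisoT Riso).
  exists b; split => // i /bl; rewrite !setTI -surjective_pairing //.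
(* even indices: the part inside the cut; odd indices: the part outside *)
pose part (W : Type) j (A C : set W) := if odd j then A `\` C else A `&` C.
pose D j := part _ j (l j./2).1 a.
pose c j n v := null (D j) -> part _ j (slice (l j./2).2 n) v = set0.
pose o j n v := ~ null (D j) -> part _ j (slice (l j./2).2 n) v !=set0.
have partB k j : j < k -> null (D j) <-> null (part _ j (l j./2).2 (B k)).
  move=> jk; have [_ /(_ j./2)] := HB k.
  have j2 : j./2 < k by rewrite (leq_ltn_trans _ jk) // -divn2 leq_div.
  by move=> /(_ j2); rewrite /cuts_alike /D /part; case: odd => -[].
have slice_part j (e C : set (nat * U)) n :
    part _ j (slice e n) (slice C n) = slice (part _ j e C) n.
  by rewrite /part; case: odd.
have [k j jk|k j jk N|d [dB dc dopen]] :=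
    @diagonal_realization (set U) c o (fun k n => slice (B k) n).
- have [Dj|Dj] := pselect (null (D j)); last by exists 0 => // n _ /Dj.
  have [/(_ Dj) H _] := partB k j jk.
  by case: H => N _ H; exists N => // n /H Hn _; rewrite slice_part.
- have [Dj|Dj] := pselect (null (D j)); first by exists N; split => // /(_ Dj).
  have [_ H] := partB k j jk; have /nullPn := contra_not H Dj => /(_ N)[n [Nn ?]].
  by exists n; split => // _; rewrite slice_part.
pose b : set (nat * U) := [set p | d p.1 p.2].
have bd n : d n = slice b n by [].
have alike j : null (D j) <-> null (part _ j (l j./2).2 b).
  have [Dj|Dj] := pselect (null (D j)); split => // H.
    by have [N _ cN] := dc j; exists N => // n /cN /(_ Dj); rewrite bd slice_part.
  exfalso; apply/(nullPn _) : H => N; have [n [Nn H]] := dopen j N.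
  by exists n; split => //; rewrite -slice_part -bd; exact: H.
exists b.
  by move=> n; have [k] := dB n; rewrite bd => ->; have [+ _] := HB k; apply.
move=> p /Rsurj[i <-]; split.
  by have := alike i.*2; rewrite /D /part odd_double doubleK.
by have := alike i.*2.+1; rewrite /D /part /= odd_double /= uphalf_double.
Qed.

(** The subalgebra generated by [R] and [(a, b)] consists of the pairs obtained
    by gluing two members of [R] along [a] and [b], so the conditions
    [cuts_alike] on members of [R] suffice. *)
Lemma one_point_extension : countable R -> exists R',
  [/\ partial_iso L M R', countable R', R `<=` R' & exists b, R' (a, b)].
Proof.
move=> cR; have [b Mb Rb] := cuts_alike_all cR.
pose glue (u v : set (nat * T) * set (nat * U)) :=
  (u.1 `&` a `|` v.1 `\` a, u.2 `&` b `|` v.2 `\` b).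
pose R' := [set glue p.1 p.2 | p in R `*` R].
have [[_ LC LI] [_ MC MI]] := (slicewise_field LF, slicewise_field MF).
have [LU MU] := (set_fieldU (slicewise_field LF), set_fieldU (slicewise_field MF)).
have fstR p : R p -> slicewise L p.1 by case: p => ? ? /(pisoL Riso).
have sndR p : R p -> slicewise M p.2 by case: p => ? ? /(pisoM Riso).
exists R'; split.
- split=> [x y|x y||x y|x y x' y'|x y].
  + case=> -[u v] [/= Ru Rv] [<- _]; rewrite setDE.
    by apply: LU; apply: LI; rewrite //; [exact: fstR|exact: fstR|exact: LC].
  + case=> -[u v] [/= Ru Rv] [_ <-]; rewrite setDE.
    by apply: MU; apply: MI; rewrite //; [exact: sndR|exact: sndR|exact: MC].
  + exists ((setT, setT), (setT, setT)); first by split; exact: (pisoT Riso).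
    by rewrite /glue /= !setTI !setTD !setUCr.
  + case=> -[u v] [/= Ru Rv] [<- <-].
    exists ((~` u.1, ~` u.2), (~` v.1, ~` v.2)).
      by split; apply: (pisoC Riso); rewrite -surjective_pairing.
    by congr (_, _) => /=; apply/seteqP; split=> z /=;
      [have := EM (a z)| have := EM (a z)|have := EM (b z)|have := EM (b z)]; tauto.
  + case=> -[u v] [/= Ru Rv] [<- <-] [] -[u' v'] [/= Ru' Rv'] [<- <-].
    exists ((u.1 `&` u'.1, u.2 `&` u'.2), (v.1 `&` v'.1, v.2 `&` v'.2)).
      by split; apply: (pisoI Riso); rewrite -surjective_pairing.
    by congr (_, _) => /=; apply/seteqP; split=> z /=; tauto.
  + case=> -[u v] [/= Ru Rv] [<- <-]; rewrite !null_setU.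
    by have [[-> _] [_ ->]] := (Rb u Ru, Rb v Rv).
- by apply: sub_countable (card_image_le _ _) _; exact: countableX.
- move=> [x y] Rxy; exists ((x, y), (x, y)) => //.
  by rewrite /glue /= !setDE -!setIUr !setUCr !setIT.
- exists b; exists ((setT, setT), (set0, set0)).
    split; first exact: (pisoT Riso).
    by rewrite /= -!setCT; exact: (pisoC Riso) (pisoT Riso).
  by rewrite /glue /= !setTI !set0D !setU0.
Qed.

End Extension.

(** * Back and forth of length omega_1 *)

(** Under the continuum hypothesis the power set of the naturals has a well-order
    in which proper initial segments are countable: in an arbitrary well-order,
    the first uncountable initial segment has the size of the whole, and its
    order can be transported. *)
Lemma CH_well_order : CH -> exists lt : set nat -> set nat -> Prop,
  [/\ well_founded lt, forall x y, [\/ lt x y, x = y | lt y x] &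
      forall x, countable [set y | lt y x]].
Proof.
move=> ch; have [R woR] := wochoice.well_ordering_principle (set nat).
have leP (A : set (set nat)) : A !=set0 -> exists x, A x /\ forall y, A y -> R x y.
  move=> [x Ax]; have [|m [[mA mle] _]] := woR (mem A).
    by exists x; rewrite inE.
  by exists m; split=> [|y Ay]; [exact/set_mem|apply: mle; rewrite inE].
have Rxx x : R x x by have [|m [->]] := leP [set x]; [exists x|apply].
have Rtot x y : R x y \/ R y x.
  have [|m [[->|->] H]] := leP [set x; y]; first by exists x; left.
    by left; apply: H; right.
  by right; apply: H; left.
have Ranti x y : R x y -> R y x -> x = y.
  move=> xy yx; have [|m [_ mu]] := woR (mem [set x; y]).
    by exists x; rewrite inE; left.
  rewrite -(mu x) ?(mu y) //; split; rewrite ?inE /=; [by right| |by left|];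
    by move=> z; rewrite inE => -[->|->].
pose s x y := R x y /\ x <> y.
have swf : well_founded s.
  move=> x; apply: contrapT => nx.
  have [|m [nm mle]] := leP [set x | ~ Acc s x]; first by exists x.
  apply: nm; constructor => y [ym ynm]; apply: contrapT => ny.
  by apply: ynm; apply: Ranti => //; exact: mle.
have [f finj fc] : exists2 f : set nat -> set nat, injective f &
    forall x, countable [set z | s z (f x)].
  have [H|/existsNP nc] := pselect (forall x, countable [set z | s z x]).
    by exists id.
  have [m [ncm mle]] := leP [set x | ~ countable [set z | s z x]] nc.
  have [//|] := ch [set z | s z m].
  rewrite card_eq_sym => /card_set_bijP[g [gm ginj _]].
  exists g => [x y gxy|x]; first by apply: ginj; rewrite ?inE.
  apply: contrapT => ncx; have [gmx ngmx] := gm x I.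
  by apply: ngmx; apply: Ranti => //; exact: mle.
exists (fun x y => s (f x) (f y)); split.
- move=> x; move: {2}(f x) (erefl (f x)) => y.
  elim/(well_founded_ind swf): y x => y IH x fxy; constructor => z szx.
  by apply: IH (erefl (f z)); rewrite -fxy.
- move=> x y; have [->|xy] := pselect (x = y); first by constructor 2.
  have nfxy : f x <> f y by move=> /finj.
  have [?|?] := Rtot (f x) (f y); first by constructor 1.
  by constructor 3; split => //; exact: nesym.
- move=> x; apply: sub_countable (fc x); apply/pcard_leP/injfunPex.
  by exists f => [y //|y z _ _ /finj].
Qed.

(** Transfinite recursion along an order with countable initial segments: starting
    from [R0], stage [x] extends the union of all earlier stages so as to meet
    the requirement of [x]. *)
Section TransfiniteChain.
Context (W P : Type) (lt : W -> W -> Prop).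
Hypotheses (lt_wf : well_founded lt)
  (lt_total : forall x y, [\/ lt x y, x = y | lt y x])
  (lt_countable : forall x, countable [set y | lt y x]).
Context (good : set P -> Prop) (meets : W -> set P -> Prop) (R0 : set P).
Hypotheses (good0 : good R0)
  (good_extend : forall x R, good R ->
     exists R', [/\ good R', R `<=` R' & meets x R'])
  (good_union : forall C : set (set P), countable C -> C !=set0 ->
     (forall R, C R -> good R) ->
     (forall R R', C R -> C R' -> R `<=` R' \/ R' `<=` R) ->
     good (\bigcup_(R in C) R)).

Lemma transfinite_chain : exists F : W -> set P,
  [/\ forall x, good (F x), forall x, meets x (F x) &
      forall x y, F x `<=` F y \/ F y `<=` F x].
Proof.
(* Off the good sets [step] is arbitrary, which makes the recursion total; that
   every stage is good is proved afterwards. *)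
have /choice[step stepP] : forall p : W * set P, exists R', good p.2 ->
    [/\ good R', p.2 `<=` R' & meets p.1 R'].
  move=> [x R]; have [gR|ngR] := pselect (good R); last by exists R.
  by have [R' ?] := good_extend x gR; exists R'.
pose below x (F : forall y, lt y x -> set P) :=
  \bigcup_(R in R0 |` [set R | exists y (h : lt y x), R = F y h]) R.
pose F := Fix lt_wf (fun=> set P) (fun x F => step (x, below x F)).
have FE x : F x = step (x, below x (fun y _ => F y)).
  rewrite /F Fix_eq // => y f g fg; rewrite (_ : f = g) //.
  by apply: functional_extensionality_dep => z; apply/funext => h; exact: fg.
suff H x : [/\ good (F x), R0 `<=` F x, forall y, lt y x -> F y `<=` F x &
               meets x (F x)].
  exists F; split=> [x|x|x y]; [by have [] := H x|by have [] := H x|].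
  have [xy|->|yx] := lt_total x y.
  - by left; have [_ _ + _] := H y; apply.
  - by left.
  - by right; have [_ _ + _] := H x; apply.
elim/(well_founded_ind lt_wf): x => x IH.
have gx : good (below x (fun y _ => F y)).
  apply: good_union.
  - rewrite (_ : [set R | _] = F @` [set y | lt y x]).
      rewrite (_ : _ `|` _ =
          \bigcup_(b in [set: bool]) if b then [set R0] else F @` [set y | lt y x]).
        apply: bigcup_countable => // -[] _; first exact: countable1.
        by apply: sub_countable (card_image_le _ _) _; exact: lt_countable.
      apply/seteqP; split => [R [RR0|FR]|R [[] _ HR]]; 
        [by exists true|by exists false|by left|by right].
    by apply/seteqP; split => [_ [y [h ->]]|_ [y h <-]]; exists y => //; exists h.
  - by exists R0; left.
  - by move=> R [->//|[y [h ->]]]; have [] := IH y h.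
  - move=> _ _ [->|[y [h ->]]] [->|[z [k ->]]]; first by left.
    + by left; have [] := IH z k.
    + by right; have [] := IH y h.
    have [yz|->|zy] := lt_total y z.
    - by left; have [_ _ + _] := IH z k; apply.
    - by left.
    - by right; have [_ _ + _] := IH y h; apply.
have [] := stepP (x, below x (fun y _ => F y)) gx; rewrite -FE /= => gF sF mF.
split => // [|y yx]; apply: subset_trans sF => p Fp.
  by exists R0 => //; left.
by exists (F y) => //; right; exists y; exists yx.
Qed.
End TransfiniteChain.

Lemma partial_iso_sym T U (L : set (set T)) (M : set (set U)) R :
  partial_iso L M R -> partial_iso M L [set p | R (p.2, p.1)].
Proof.
move=> [RL RM RT RC RI Rn]; split => /=.
- by move=> b a /RM.
- by move=> b a /RL.
- exact: RT.
- by move=> b a /RC.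
- by move=> b a b' a' /RI; apply.
- by move=> b a /Rn; tauto.
Qed.

Lemma partial_iso_bigcup T U (L : set (set T)) (M : set (set U))
    (C : set (set (set (nat * T) * set (nat * U)))) :
  C !=set0 -> (forall R, C R -> partial_iso L M R) ->
  (forall R R', C R -> C R' -> R `<=` R' \/ R' `<=` R) ->
  partial_iso L M (\bigcup_(R in C) R).
Proof.
move=> [R0 CR0] Ciso Cch; split.
- by move=> a b [R /Ciso Riso]; exact: pisoL Riso _ _.
- by move=> a b [R /Ciso Riso]; exact: pisoM Riso _ _.
- by exists R0 => //; exact: pisoT (Ciso _ CR0).
- by move=> a b [R CR Rab]; exists R => //; exact: pisoC (Ciso _ CR) _ _ Rab.
- move=> a b a' b' [R CR Rab] [R' CR' Rab'].
  have [RR|RR] := Cch _ _ CR CR'.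
    by exists R' => //; apply: (pisoI (Ciso _ CR')) => //; exact: RR.
  by exists R => //; apply: (pisoI (Ciso _ CR)) => //; exact: RR.
- by move=> a b [R /Ciso Riso]; exact: piso_null Riso _ _.
Qed.

(** Back and forth: stage [A] of the chain puts the element coded by [A] into the
    domain and into the range.  As [T] and [U] are countable, subsets of the
    naturals are enough to code all sequences of their subsets. *)
Lemma reduced_power_iso (T U : countType) (L : set (set T)) (M : set (set U)) :
  CH -> inhabited T -> inhabited U -> set_field L -> set_field M ->
  exists R, [/\ partial_iso L M R,
    forall a, slicewise L a -> exists b, R (a, b) &
    forall b, slicewise M b -> exists a, R (a, b)].
Proof.
move=> ch [t] [u] LF MF.
have [lt [ltwf lttot ltc]] := CH_well_order ch.
pose code (V : countType) (A : set nat) : set V := [set p | A (pickle p)].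
have codeP (V : countType) (E : set V) : exists A, code V A = E.
  exists (pickle @` E); apply/seteqP.
  split => [p [q Eq /(pcan_inj (@pickleK V)) <- //]|p Ep].
  by exists p.
pose good R := partial_iso L M R /\ countable R.
pose meets A (R : set (set (nat * T) * set (nat * U))) :=
  (slicewise L (code _ A) -> exists b, R (code _ A, b)) /\
  (slicewise M (code _ A) -> exists a, R (a, code _ A)).
have nullT (V : Type) (v : V) : ~ null [set: nat * V].
  by apply/nullPn => N; exists N; split => //; exists v.
have good0 : good [set (setT, setT); (set0, set0)].
  split; last first.
    by apply: finite_set_countable; rewrite finite_setU; split; exact: finite_set1.
  have [[LT _ _] L0] := (slicewise_field LF, set_field0 (slicewise_field LF)).
  have [[MT _ _] M0] := (slicewise_field MF, set_field0 (slicewise_field MF)).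
  split.
  - by move=> a b [[-> _]|[-> _]].
  - by move=> a b [[_ ->]|[_ ->]].
  - by left.
  - by move=> a b [[-> ->]|[-> ->]]; rewrite ?setC0 ?setCT; [right|left].
  - move=> a b a' b' [[-> ->]|[-> ->]]; rewrite ?setTI ?set0I //.
    by right.
  - move=> a b [[-> ->]|[-> ->]]; last by split=> _; exact: null0.
    by split => [/(nullT _ t)|/(nullT _ u)].
have good_extend A R : good R -> exists R', [/\ good R', R `<=` R' & meets A R'].
  move=> [Riso Rc].
  have [R1 [R1iso R1c RR1 R1A]] : exists R', [/\ partial_iso L M R', countable R',
      R `<=` R' & slicewise L (code _ A) -> exists b, R' (code _ A, b)].
    have [LA|nLA] := pselect (slicewise L (code _ A)); last first.
      by exists R; split => // /nLA.
    by have [R' [? ? ? ?]] := one_point_extension LF MF Riso LA Rc; exists R'.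
  have [MA|nMA] := pselect (slicewise M (code _ A)); last first.
    by exists R1; split => //; split => // /nMA.
  have [|R' [R'iso R'c RR' [b R'b]]] :=
    one_point_extension MF LF (partial_iso_sym R1iso) MA.
    apply: sub_countable R1c; apply/pcard_leP/injfunPex.
    exists (fun p => (p.2, p.1)) => [[x y] //|[x y] [x' y'] _ _ /= [-> ->] //].
  have R1R' p : R1 p -> R' (p.2, p.1) by move=> R1p; apply: RR'; case: p R1p.
  exists [set p | R' (p.2, p.1)]; split; first split.
  - exact: partial_iso_sym R'iso.
  - apply: sub_countable R'c; apply/pcard_leP/injfunPex.
    exists (fun p => (p.2, p.1)) => [[x y] //|[x y] [x' y'] _ _ /= [-> ->] //].
  - by move=> p /RR1 /R1R'.
  - by split => [/R1A[c /R1R' ?]|_]; [exists c|exists b].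
have good_union C : countable C -> C !=set0 -> (forall R, C R -> good R) ->
     (forall R R', C R -> C R' -> R `<=` R' \/ R' `<=` R) ->
     good (\bigcup_(R in C) R).
  move=> Cc C0 Cg Cch; split; last by apply: bigcup_countable => // R /Cg[].
  by apply: partial_iso_bigcup => // R /Cg[].
have [F [Fg Fm Fch]] :=
  transfinite_chain ltwf lttot ltc good0 good_extend good_union.
exists (\bigcup_(R in range F) R); split.
- apply: partial_iso_bigcup; first by exists (F set0), set0.
    by move=> _ [x _ <-]; have [] := Fg x.
  by move=> _ _ [x _ <-] [y _ <-].
- move=> a; have [A <-] := codeP _ a => LA; have [/(_ LA)[b Fb] _] := Fm A.
  by exists b, (F A) => //; exists A.
- move=> b; have [A <-] := codeP _ b => MA; have [_ /(_ MA)[a Fa]] := Fm A.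
  by exists a, (F A) => //; exists A.
Qed.

(** * Two fields of sets on the countable Cantor tree *)

Section CantorFields.
Implicit Types (x y : seq bool) (b c p : set (seq bool)).

(** Words are compared as infinite sequences padded with [false]. *)
Definition agree k x y : Prop := forall i, i < k -> nth false x i = nth false y i.

Lemma agreexx k x : agree k x x. Proof. by []. Qed.
Lemma agree_sym k x y : agree k x y -> agree k y x.
Proof. by move=> xy i /xy. Qed.
Lemma agree_trans k x y z : agree k x y -> agree k y z -> agree k x z.
Proof. by move=> xy yz i ik; rewrite xy ?yz. Qed.
Lemma agreeW k l x y : k <= l -> agree l x y -> agree k x y.
Proof. by move=> kl xy i ik; apply: xy; exact: leq_trans kl. Qed.

Definition cylinder k x : set (seq bool) := [set y | agree k x y].

Definition uniformly_clopen : set (set (seq bool)) :=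
  [set c | exists k, forall x y, agree k x y -> c x -> c y].

Definition locally_clopen : set (set (seq bool)) :=
  [set c | forall x, exists k, forall y, agree k x y -> (c x <-> c y)].

Lemma uniformly_clopen_field : set_field uniformly_clopen.
Proof.
split.
- by exists 0.
- by move=> c [k ck]; exists k => x y xy ncx /(ck _ _ (agree_sym xy)).
- move=> b c [k bk] [l cl]; exists (maxn k l) => x y xy [bx cx]; split.
    by apply: bk bx; apply: agreeW xy; rewrite leq_maxl.
  by apply: cl cx; apply: agreeW xy; rewrite leq_maxr.
Qed.

Lemma locally_clopen_field : set_field locally_clopen.
Proof.
split.
- by move=> x; exists 0.
- by move=> c cL x; have [k ck] := cL x; exists k => y /ck; rewrite /setC /=; tauto.
- move=> b c bL cL x; have [[k bk] [l cl]] := (bL x, cL x).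
  exists (maxn k l) => y xy.
  have := bk y (agreeW (leq_maxl _ _) xy).
  have := cl y (agreeW (leq_maxr _ _) xy); rewrite /setI /=; tauto.
Qed.

Lemma uniformly_clopen_locally c : uniformly_clopen c -> locally_clopen c.
Proof.
move=> [k ck] x; exists k => y xy.
by split; apply: ck => //; exact: agree_sym.
Qed.

Lemma cylinder_uniformly_clopen k x : uniformly_clopen (cylinder k x).
Proof. by exists k => y z yz; rewrite /cylinder /= => /agree_trans; exact. Qed.

(** The cylinder around a point that witnesses the clopenness of [b] there. *)
Lemma uniformly_clopen_dense b : locally_clopen b -> b !=set0 ->
  exists c, [/\ uniformly_clopen c, c !=set0 & c `<=` b].
Proof.
move=> bL [x bx]; have [k bk] := bL x; exists (cylinder k x); split.
- exact: cylinder_uniformly_clopen.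
- by exists x; exact: agreexx.
- by move=> y /bk[+ _]; exact.
Qed.

(** Every word ends in zeros, so that a first zero at or after position [k]
    always exists, but its position is not determined by a bounded number of
    digits. *)
Definition first_zero k x j : Prop :=
  (forall i, i < j -> nth false x (k + i)) /\ nth false x (k + j) = false.

Lemma first_zero_exists k x : exists j, first_zero k x j.
Proof.
have ex : exists j, ~~ nth false x (k + j).
  by exists (size x); rewrite nth_default // leq_addl.
have [j xj jmin] := ex_minnP ex; exists j; split; last exact/negbTE.
by move=> i ij; apply: contraTT ij => /jmin; rewrite -leqNgt.
Qed.

Lemma first_zero_inj k x i j : first_zero k x i -> first_zero k x j -> i = j.
Proof.
move=> [xi xi0] [xj xj0]; case: (ltngtP i j) => // [/xj|/xi].
  by rewrite xi0.
by rewrite xj0.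
Qed.

Lemma first_zero_agree k x y j : agree (k + j).+1 x y ->
  first_zero k x j -> first_zero k y j.
Proof.
move=> xy [x1 x0]; split=> [i ij|]; last by rewrite -xy.
by rewrite -xy ?x1 // ltnS leq_add2l ltnW.
Qed.

(** Inside a cylinder contained in [b], the parity of the position of the first
    zero is locally, but not uniformly, determined by digits: near the missing
    point whose further digits are all one, both parities occur. *)
Lemma uniformly_clopen_nowhere_full b : locally_clopen b -> b !=set0 ->
  exists c, [/\ locally_clopen c, c `<=` b &
    forall p, uniformly_clopen p -> p `&` b <> c].
Proof.
move=> bL [x bx]; have [k bk] := bL x.
pose even_zero := [set y | exists2 j, first_zero k y j & ~~ odd j].
exists (cylinder k x `&` even_zero); split; last 1 first.
move=> p [l pl] pbc.
(* [pt m] follows [x] up to [k], then has [m] ones and zeros from there on. *)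
pose pt m := mkseq (fun i => if i < k then nth false x i else i < k + m) (k + m).
have ptE m i : nth false (pt m) i = if i < k then nth false x i else i < k + m.
  have [im|im] := ltnP i (k + m); first by rewrite nth_mkseq // im.
  rewrite nth_default ?size_mkseq //; case: ifP => //.
  by rewrite ltnNge (leq_trans _ im) // leq_addr.
have ptx m : agree k x (pt m) by move=> i ik; rewrite ptE ik.
have pt0 m : first_zero k (pt m) m.
  split=> [i im|]; rewrite ptE ltnNge leq_addr /=; first by rewrite ltn_add2l.
  by rewrite ltnn.
have : (cylinder k x `&` even_zero) (pt l.*2).
  by split; [exact: ptx|exists l.*2 => //; rewrite odd_double].
rewrite -pbc => -[pp _].
have : (cylinder k x `&` even_zero) (pt l.*2.+1).
  rewrite -pbc; split; last by have [+ _] := bk _ (ptx l.*2.+1); exact.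
  apply: pl pp => i il; rewrite !ptE; case: ifP => // _.
  have il2 : i < k + l.*2 by rewrite (leq_trans il) // -addnn addnA leq_addl.
  by rewrite il2 addnS ltnS ltnW.
by move=> [_ [j /(first_zero_inj (pt0 _)) <-]]; rewrite /= odd_double.
- have [_ _] := locally_clopen_field; apply.
    exact/uniformly_clopen_locally/cylinder_uniformly_clopen.
  move=> y; have [j yj] := first_zero_exists k y.
  exists (k + j).+1 => z yz; have zj := first_zero_agree yz yj.
  split=> -[i yi ei]; exists j => //.
    by rewrite (first_zero_inj yj yi).
  by rewrite (first_zero_inj zj yi).
- by move=> y [/bk[+ _] _]; exact.
Qed.

End CantorFields.

Definition almost_empty (A : set nat) : Prop := \forall n \near \oo, ~ A n.

(** An injective homomorphism of the algebra of sets of naturals modulo finite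
    into itself, lifted to sets.  Its range is dense, while on every set [B] that
    is not finite some [C] has a trace that no member of the range has. *)
Record dense_embedding (phi : set nat -> set nat) : Prop := DenseEmbedding {
  phiI : forall A B, \forall n \near \oo, phi (A `&` B) n <-> (phi A `&` phi B) n;
  phiC : forall A, \forall n \near \oo, phi (~` A) n <-> ~ phi A n;
  phi0 : forall A, almost_empty (phi A) <-> almost_empty A;
  phi_dense : forall B, ~ almost_empty B ->
    exists2 A, ~ almost_empty A & almost_empty (phi A `\` B);
  phi_nowhere_full : forall B, ~ almost_empty B ->
    exists C, forall A, ~ \forall n \near \oo, B n -> (phi A n <-> C n)
}.

Definition unit_power (A : set nat) : set (nat * unit) := [set p | A p.1].

Lemma null_unit_power A : null (unit_power A) <-> almost_empty A.
Proof.
split=> -[N _ NA]; exists N => // n Nn.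
  by move=> An; have := NA n Nn; rewrite predeqE => /(_ tt) [/(_ An)].
by rewrite -subset0 => t; exact: NA.
Qed.

(** The composite of an isomorphism onto the reduced power of the uniformly clopen
    sets, the inclusion, and the inverse of an isomorphism onto the reduced power
    of the locally clopen sets.  Sets of naturals are themselves the reduced
    power of the field of subsets of a point. *)
Lemma dense_embedding_exists : CH -> exists phi, dense_embedding phi.
Proof.
move=> ch.
have F1 : set_field [set: set unit] by [].
have [R1 [R1iso R1tot R1onto]] :=
  reduced_power_iso ch (inhabits tt) (inhabits [::]) F1
  uniformly_clopen_field.
have [R2 [R2iso R2tot R2onto]] :=
  reduced_power_iso ch (inhabits tt) (inhabits [::]) F1
  locally_clopen_field.
pose Q A B := exists2 E, R1 (unit_power A, E) & R2 (unit_power B, E).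
have unit_powerK E : exists A, unit_power A = E.
  exists [set n | E (n, tt)]; by apply/seteqP; split => -[n []].
have /choice[phi Qphi] : forall A, exists B, Q A B.
  move=> A; have [//|E RE] := R1tot (unit_power A).
  have [|F RF] := R2onto E.
    by move=> n; apply: uniformly_clopen_locally; exact: (pisoM R1iso RE).
  by have [B BF] := unit_powerK F; exists B, E => //; rewrite BF.
have QC A B : Q A B -> Q (~` A) (~` B).
  move=> [E R1E R2E]; exists (~` E); first exact: pisoC R1iso _ _ R1E.
  exact: pisoC R2iso _ _ R2E.
have QI A B A' B' : Q A B -> Q A' B' -> Q (A `&` A') (B `&` B').
  move=> [E R1E R2E] [E' R1E' R2E']; exists (E `&` E').
    exact: pisoI R1iso _ _ _ _ R1E R1E'.
  exact: pisoI R2iso _ _ _ _ R2E R2E'.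
have Qn A B : Q A B -> almost_empty B <-> almost_empty A.
  move=> [E /(piso_null R1iso) + /(piso_null R2iso)].
  by rewrite !null_unit_power; tauto.
have Quniq A B B' : Q A B -> Q A B' -> \forall n \near \oo, B n <-> B' n.
  move=> QB QB'; have e0 : almost_empty (A `&` ~` A) by exists 0 => // n _ [].
  have /Qn[_ /(_ e0) BB'] := QI _ _ _ _ QB (QC _ _ QB').
  have /Qn[_ /(_ e0) B'B] := QI _ _ _ _ QB' (QC _ _ QB).
  near=> n.
  have h1 : ~ (B `&` ~` B') n by near: n; exact: BB'.
  have h2 : ~ (B' `&` ~` B) n by near: n; exact: B'B.
  move: h1 h2; rewrite /setI /setC /=.
  by case: (EM (B n)); case: (EM (B' n)); tauto.
exists phi; split.
- by move=> A B; apply: Quniq (Qphi _) (QI _ _ _ _ (Qphi A) (Qphi B)).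
- by move=> A; apply: Quniq (Qphi _) (QC _ _ (Qphi A)).
- by move=> A; exact: Qn (Qphi A).
- move=> B B0; have [//|E R2E] := R2tot (unit_power B).
  have E0 : ~ null E by rewrite -(piso_null R2iso R2E) null_unit_power.
  have /choice[c cP] : forall n, exists c, uniformly_clopen c /\ c `<=` slice E n /\
      (slice E n !=set0 -> c !=set0).
    move=> n; have [En|En] := pselect (slice E n !=set0).
      have [c [? ? ?]] := uniformly_clopen_dense (pisoM R2iso R2E n) En.
      by exists c.
    by exists set0; split; [exact: set_field0 uniformly_clopen_field|split].
  pose F : set (nat * seq bool) := [set p | c p.1 p.2].
  have FE : F `<=` E by move=> [n t]; have [_ [+ _]] := cP n; exact.
  have [|a R1F] := R1onto F; first by move=> n; have [] := cP n.
  have [A aA] := unit_powerK a; subst a.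
  have F0 : ~ null F.
    apply/nullPn => N; have [n [Nn En]] := (iffLR (nullPn E)) E0 N.
    by exists n; split => //; have [_ [_]] := cP n; exact.
  exists A; first by rewrite -null_unit_power (piso_null R1iso R1F).
  have [G R1G R2G] := Qphi A.
  have := pisoD R2iso R2G R2E; rewrite -/(unit_power (phi A `\` B)) => H.
  rewrite -null_unit_power; apply/(piso_null R2iso H).
  have := pisoD R1iso R1G R1F; rewrite setDv => /(piso_null R1iso)[/(_ (null0 _)) GF _].
  by apply: null_sub GF => x [Gx Ex]; split => // /FE.
- move=> B B0; have [//|E R2E] := R2tot (unit_power B).
  have E0 : ~ null E by rewrite -(piso_null R2iso R2E) null_unit_power.
  have /choice[c cP] : forall n, exists c, [/\ locally_clopen c,
      c `<=` slice E n & slice E n !=set0 ->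
      forall p, uniformly_clopen p -> p `&` slice E n <> c].
    move=> n; have [En|En] := pselect (slice E n !=set0).
      have [c [? ? ?]] := uniformly_clopen_nowhere_full (pisoM R2iso R2E n) En.
      by exists c.
    by exists set0; split => //; exact: set_field0 locally_clopen_field.
  pose F : set (nat * seq bool) := [set p | c p.1 p.2].
  have FE : F `<=` E by move=> [n t]; have [_ + _] := cP n; exact.
  have [|f R2F] := R2onto F; first by move=> n; have [] := cP n.
  have [C fC] := unit_powerK f; subst f; exists C => A [N0 _ AC].
  have [G R1G R2G] := Qphi A.
  have GEF : null (G `&` E `\` F).
    apply/(piso_null R2iso (pisoD R2iso (pisoI R2iso R2G R2E) R2F)).
    apply/nullP; exists N0 => n t [[/= Gn Bn] Cn]; rewrite ltnNge; apply/negP => Nn.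
    by apply: Cn; exact/(AC n Nn Bn).
  have FEG : null (F `&` E `\` G).
    apply/(piso_null R2iso (pisoD R2iso (pisoI R2iso R2F R2E) R2G)).
    apply/nullP; exists N0 => n t [[/= Cn Bn] Gn]; rewrite ltnNge; apply/negP => Nn.
    by apply: Gn; exact/(AC n Nn Bn).
  have /nullP[N HN] : null ((G `&` E `\` F) `|` (F `&` E `\` G)) by apply/null_setU.
  have [n [Nn En]] := (iffLR (nullPn E)) E0 N.
  have [_ cE /(_ En (slice G n) (pisoM R1iso R1G n))] := cP n; apply.
  have N't t : ~ ((G `&` E `\` F) `|` (F `&` E `\` G)) (n, t).
    by move=> /HN; rewrite ltnNge Nn.
  apply/seteqP; split => [t [Gt Et]|t ct].
    by apply: contrapT => nct; apply: (N't t); left.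
  split; last exact: cE.
  by apply: contrapT => nGt; apply: (N't t); right; split => //; split => //; exact: cE.
Unshelve. all: by end_near.
Qed.

(** * Points of the remainder as free ultrafilters, and the dual map *)

Definition ult (x : Nstar) : set_system nat := ultra_of (set_val x).

#[global] Instance ult_ultra x : UltraFilter (ult x).
Proof. exact: ultra_ofP. Qed.

Lemma in_star A x : star A x <-> ult x A.
Proof. by rewrite starE. Qed.

(** A singleton belongs to a principal ultrafilter only, so that the points of the
    remainder are the ultrafilters that contain all cofinite sets. *)
Lemma ultra_principal n u : ultra_of u [set n] -> u = inN n.
Proof.
move=> un; apply: betaN_eq => /=; have fu := ultra_ofP u.
apply: (@max_filter _ _ (principal_filter_ultra n)).
by move=> A /principal_filterP An; apply: filterS un => _ ->.
Qed.

Lemma ultC x A : ult x (~` A) <-> ~ ult x A.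
Proof.
split=> [uC uA|nA]; first by have [n []] := filter_ex (filterI uC uA).
by have [] := in_ultra_setVsetC A (ult_ultra x).
Qed.

Lemma ult_free x A : (\forall n \near \oo, A n) -> ult x A.
Proof.
move=> [N _ NA]; apply: filterS NA _.
elim: N => [|N IH]; first by apply: filterS filterT.
have : ult x (~` [set N]).
  apply/ultC => /ultra_principal xN; have /set_mem := valP x.
  by apply; exists N => //; rewrite -xN.
apply: filterS2 IH => n /= Nn nN; rewrite ltn_neqAle Nn andbT.
by apply/eqP => /esym.
Qed.

Lemma ult_mono x A B : (\forall n \near \oo, A n -> B n) -> ult x A -> ult x B.
Proof. by move=> /(ult_free x); apply: filterS2 => n; apply. Qed.

Lemma ult_iff x A B : (\forall n \near \oo, A n <-> B n) -> ult x A <-> ult x B.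
Proof. by move=> AB; split; apply: ult_mono; apply: filterS AB => n []. Qed.

Lemma ultI x A B : ult x (A `&` B) <-> ult x A /\ ult x B.
Proof.
split=> [AB|[]]; last exact: filterI.
by split; apply: filterS AB => n [].
Qed.

Lemma ult_inj x y : (forall A, ult x A -> ult y A) -> x = y.
Proof.
move=> xy; apply: val_inj; apply: betaN_eq; apply/esym.
exact: (@max_filter _ _ (ult_ultra x)).
Qed.

Lemma Nstar_of_ultra (U : set_system nat) : UltraFilter U -> \oo `<=` U ->
  exists x, ult x = U.
Proof.
move=> UU Uoo; have xN : (~` range inN) (BetaN UU).
  move=> [n _ [nU]]; have : U (~` [set n]).
    by apply: Uoo; exists n.+1 => // m /= nm mn; rewrite mn ltnn in nm.
  by rewrite -nU => /principal_filterP; exact.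
by exists (exist (fun x => x \in ~` range inN) _ (mem_set xN)).
Qed.

Lemma Nstar_extend (F : set_system nat) : ProperFilter F -> \oo `<=` F ->
  exists x, F `<=` ult x.
Proof.
move=> FF Foo; have [U [UU FU]] := ultraFilterLemma FF.
have [|x xU] := Nstar_of_ultra UU; first exact: subset_trans FU.
by exists x; rewrite xU.
Qed.

Lemma star_base (V : set Nstar) x : open V -> V x ->
  exists2 A, ult x A & star A `<=` V.
Proof.
move=> [W [D _ DW] <-] /=; rewrite -DW => -[A DA uA]; exists A => //.
by rewrite starE => y yA; exists A.
Qed.

Lemma star_nbhs x A : ult x A -> nbhs x (star A).
Proof.
move=> xA; apply: open_nbhs_nbhs; split; last exact/in_star.
by have [] := star_clopen A.
Qed.

Lemma ult_almost_empty x A : ult x A -> ~ almost_empty A.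
Proof. by move=> uA /(ult_free x) /(ultC x A). Qed.

Lemma star_nonempty A : ~ almost_empty A -> exists x, ult x A.
Proof.
move=> A0; pose F := [set B | \forall n \near \oo, A n -> B n].
have FF : ProperFilter F.
  apply: Build_ProperFilter_ex.
    move=> B FB; apply: contrapT => B0; apply: A0; case: FB => N _ FB.
    by exists N => // n /FB AB /AB Bn; apply: B0; exists n.
  split.
  - by exists 0.
  - by rewrite /F => B C /=; apply: filterS2 => n AB AC An; split; auto.
  - by rewrite /F => B C BC /=; apply: filterS => n AB /AB /BC.
have [|x xF] := Nstar_extend FF.
  by move=> B; apply: filterS => n.
by exists x; apply: xF; exists 0.
Qed.

(** Nowhere density tested on the clopen base: every nonempty basic set contains a
    nonempty basic set that misses [F]. *)
Lemma nowhere_denseP (F : set Nstar) : nowhere_dense F <->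
  forall A, ~ almost_empty A -> exists B,
    [/\ ~ almost_empty B, B `<=` A & forall x, ult x B -> ~ F x].
Proof.
split=> [F0 A A0|FA].
  have [x xA nFx] : exists2 x, ult x A & ~ closure F x.
    apply: contrapT => H; have [x xA] := star_nonempty A0.
    have : (closure F)^° x.
      apply: filterS (star_nbhs xA) => y /in_star yA.
      by apply: contrapT => nFy; apply: H; exists y.
    by rewrite F0.
  have [//|B xB BF] := @star_base (~` closure F) x _ nFx.
    by apply: closed_openC; exact: closed_closure.
  exists (A `&` B); split.
  - by apply: (@ult_almost_empty x); apply/ultI.
  - by move=> n [].
  - move=> y /ultI[_ yB] Fy; apply: (BF y); first exact/in_star.
    exact: subset_closure.
rewrite /nowhere_dense -subset0 => x; rewrite /interior nbhsE => -[V [oV Vx] VF].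
have [A xA AV] := star_base oV Vx.
have [B [B0 BA BF]] := FA A (ult_almost_empty xA).
have [y yB] := star_nonempty B0.
have yA : star A y by apply/in_star; apply: filterS yB.
have [|z [Fz /in_star zB]] := VF y (AV _ yA) (star B).
  exact: star_nbhs.
exact: BF zB Fz.
Qed.

Lemma almost_emptyD A B :
  almost_empty (A `\` B) <-> \forall n \near \oo, A n -> B n.
Proof.
rewrite /almost_empty; split; apply: filterS => n.
  by move=> nAB An; apply: contrapT => nBn; apply: nAB.
by move=> AB [/AB].
Qed.

Lemma infinite_almost_empty A : infinite_set A -> ~ almost_empty A.
Proof.
move=> Ainf [N _ NA]; apply: Ainf; apply: sub_finite_set (finite_II N) => n An /=.
by rewrite ltnNge; apply/negP => /NA.
Qed.

Section Psi.
Context (phi : set nat -> set nat) (phiP : dense_embedding phi).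

Lemma phi_almost_sub A B : almost_empty (A `\` B) ->
  \forall n \near \oo, phi A n -> phi B n.
Proof.
move=> /(phi0 phiP); rewrite setDE => AB0.
near=> n => An; apply: contrapT => nBn.
have : ~ phi (A `&` ~` B) n by near: n; exact: AB0.
apply; have -> : phi (A `&` ~` B) n <-> (phi A `&` phi (~` B)) n.
  by near: n; exact: phiI.
split => //; have -> : phi (~` B) n <-> ~ phi B n by near: n; exact: phiC.
by [].
Unshelve. all: by end_near. Qed.

Lemma phiU A B : \forall n \near \oo, phi (A `|` B) n -> phi A n \/ phi B n.
Proof.
near=> n.
have e : phi (~` (A `|` B)) n <-> ~ phi (A `|` B) n by near: n; exact: phiC.
have e1 : phi (~` A) n <-> ~ phi A n by near: n; exact: phiC.
have e2 : phi (~` B) n <-> ~ phi B n by near: n; exact: phiC.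
have : phi (~` A `&` ~` B) n <-> (phi (~` A) `&` phi (~` B)) n.
  by near: n; exact: phiI.
rewrite -setCU /setI /=; case: (EM (phi A n)); case: (EM (phi B n)); tauto.
Unshelve. all: by end_near. Qed.

(** Stone duality: the inverse image of a free ultrafilter under a homomorphism
    modulo finite is a free ultrafilter. *)
Lemma psi_exists : exists psi : Nstar -> Nstar,
  forall x A, ult (psi x) A <-> ult x (phi A).
Proof.
suff /choice[psi psiP] : forall x, exists y, ult y = [set A | ult x (phi A)].
  by exists psi => x A; rewrite psiP.
move=> x; set F := [set A | ult x (phi A)].
have Foo : \oo `<=` F.
  move=> A Aoo; have A0 : almost_empty (~` A) by apply: filterS Aoo => n An; apply.
  have /(phi0 phiP) := A0 => A0'.
  have := phiC phiP (~` A); rewrite setCK => e.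
  by apply: ult_free; apply: filterS2 e A0' => n [_].
have FF : ProperFilter F.
  apply: Build_ProperFilter_ex.
    move=> A FA; apply: contrapT => A0; apply: (ult_almost_empty FA).
    by apply/(phi0 phiP); exists 0 => // n _ An; apply: A0; exists n.
  split.
  - by apply: Foo; exists 0.
  - move=> A B FA FB; rewrite /F /=; apply/(ult_iff _ (phiI phiP A B)).
    exact/ultI.
  - move=> A B AB; apply: ult_mono; apply: phi_almost_sub.
    by exists 0 => // n _ [/AB].
apply: Nstar_of_ultra => //; split => // G GG FG; apply/seteqP; split => // A GA.
apply: contrapT => nFA; have GnA : G (~` A).
  by apply: FG; rewrite /F /=; apply/(ult_iff _ (phiC phiP A))/ultC.
by have [n []] := filter_ex (filterI GA GnA).
Qed.

Context (psi : Nstar -> Nstar) (psiP : forall x A, ult (psi x) A <-> ult x (phi A)).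

Lemma psi_continuous : continuous psi.
Proof.
apply/continuousP => V oV; rewrite openE => x /= Vx.
have [A xA AV] := star_base oV Vx.
move/psiP/star_nbhs : xA; apply: filterS => y /in_star /psiP yA.
by apply: AV; apply/in_star.
Qed.

(** The fibre over [w] meets the clopen set of [C] as soon as the sets [phi A],
    for [A] in [w], together with [C] generate a proper filter. *)
Lemma psi_preimage_in w C : (forall A, ult w A -> ~ almost_empty (phi A `&` C)) ->
  exists2 x, ult x C & psi x = w.
Proof.
move=> wC; pose F := [set D | exists2 A, ult w A &
  \forall n \near \oo, (phi A `&` C) n -> D n].
have FF : ProperFilter F.
  apply: Build_ProperFilter_ex.
    move=> D [A wA AD]; apply: contrapT => D0; apply: (wC A wA).
    by apply: filterS AD => n + ACn => /(_ ACn) Dn; apply: D0; exists n.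
  split.
  - by exists setT; [exact: filterT|exists 0].
  - move=> D D' [A wA AD] [A' wA' AD']; exists (A `&` A'); first exact/ultI.
    apply: filterS3 AD AD' (phiI phiP A A') => n HD HD' HI [/HI[An A'n] Cn].
    by split; [apply: HD|apply: HD'].
  - move=> D E DE [A wA AD]; exists A => //.
    by apply: filterS AD => n AD /AD /DE.
have [|x xF] := Nstar_extend FF.
  by move=> D Doo; exists setT; [exact: filterT|apply: filterS Doo].
exists x.
  by apply: xF; exists setT; [exact: filterT|exists 0 => // n _ []].
apply/esym/ult_inj => A wA; apply/psiP; apply: xF; exists A => //.
by exists 0 => // n _ [].
Qed.

Lemma psi_surj w : exists x, psi x = w.
Proof.
have [|x _ xw] := @psi_preimage_in w setT; last by exists x.
by move=> A wA; rewrite setIT => /(phi0 phiP); exact: ult_almost_empty wA.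
Qed.

(** Density of [phi] provides a basic set whose full preimage lies in the given
    open set; by surjectivity this basic set is covered by the image. *)
Lemma psi_quasi_open : quasi_open psi.
Proof.
split=> [|V oV [x Vx]]; first exact: psi_continuous.
have [B xB BV] := star_base oV Vx.
have [A A0 AB] := phi_dense phiP (ult_almost_empty xB).
have [w wA] := star_nonempty A0; exists w.
apply: filterS (star_nbhs wA) => v /in_star vA.
have [y yv] := psi_surj v; exists y => //.
apply: BV; apply/in_star; rewrite -yv psiP in vA; apply: ult_mono vA.
exact/almost_emptyD.
Qed.

(** A basic set missing [F] contains the full preimage of another basic set, which
    then misses the image of [F]. *)
Lemma psi_image_nowhere_dense F : nowhere_dense F -> nowhere_dense (psi @` F).
Proof.
move=> /nowhere_denseP FF; apply/nowhere_denseP => A A0.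
have [|B [B0 BA BF]] := FF (phi A); first by move=> /(phi0 phiP).
have [A' A'0 A'B] := phi_dense phiP B0.
have [w wA'] : exists w, ult w (phi A').
  by apply: star_nonempty => /(phi0 phiP).
have A'Bn : \forall n \near \oo, phi A' n -> B n.
  exact/almost_emptyD.
exists (A `&` A'); split.
- apply: (@ult_almost_empty (psi w)); apply/ultI; split; apply/psiP => //.
  by apply: filterS BA _; exact: ult_mono A'Bn wA'.
- by move=> n [].
- move=> _ /ultI[_ /[swap] -[x Fx <-] /psiP xA']; apply: (BF x) Fx.
  exact: ult_mono A'Bn xA'.
Qed.

Lemma psi_preimage_nowhere_dense F : nowhere_dense F -> nowhere_dense (psi @^-1` F).
Proof.
move=> /nowhere_denseP FF; apply/nowhere_denseP => B B0.
have [A A0 AB] := phi_dense phiP B0.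
have [A1 [A10 A1A A1F]] := FF A A0.
exists (phi A1 `&` B); split.
- have [|x xA1] := @star_nonempty (phi A1); first by move=> /(phi0 phiP).
  apply: (@ult_almost_empty x); apply/ultI; split => //.
  have : ult x (phi A) by apply/psiP; apply: filterS A1A _; apply/psiP.
  exact/ult_mono/almost_emptyD.
- by move=> n [].
- by move=> x /ultI[/psiP xA1 _]; exact: A1F.
Qed.

(** Take [C] whose trace on [B] is not the trace of any [phi A].  Then the sets
    [D] with [phi D] almost disjoint from [B `&` C] and those with [phi D] almost
    disjoint from [B `\` C] generate a proper ideal: if [D1] and [D2] of the two
    kinds covered everything, [phi D2] would have the trace of [C] on [B].  An
    ultrafilter [w] that avoids this ideal has preimages on both sides of [C]. *)
Lemma psi_not_injective B : ~ almost_empty B ->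
  exists x y, [/\ ult x B, ult y B, psi x = psi y & x <> y].
Proof.
move=> B0; have [C HC] := phi_nowhere_full phiP B0.
pose small K D := \forall n \near \oo, B n -> K n -> ~ phi D n.
pose F := [set A | exists D1 D2, [/\ small C D1, small (~` C) D2 &
  ~` A `<=` D1 `|` D2]].
have smallU K D D' : small K D -> small K D' -> small K (D `|` D').
  rewrite /small => KD KD'; apply: filterS3 KD KD' (phiU D D') => n HD HD' HU Bn Kn.
  by move=> /HU[]; [exact: HD|exact: HD'].
have small_almost_empty K D : almost_empty D -> small K D.
  by move=> /(phi0 phiP)[N _ ND]; exists N => // n Nn _ _; exact: ND.
have FF : ProperFilter F.
  apply: Build_ProperFilter_ex.
    move=> A [D1 [D2 [s1 s2 AD]]]; apply: contrapT => A0.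
    have DT n : D1 n \/ D2 n by apply: AD => An; apply: A0; exists n.
    apply: (HC D2).
    have D12 : \forall n \near \oo, phi (~` D2) n -> phi D1 n.
      by apply: phi_almost_sub; exists 0 => // n _ [nD2 nD1]; case: (DT n).
    near=> n => Bn; split => [Dn|Cn].
      apply: contrapT => nCn; suff : ~ phi D2 n by [].
      by move: Bn nCn; near: n; exact: s2.
    have nD1 : ~ phi D1 n by move: Bn Cn; near: n; exact: s1.
    apply: contrapT => nD2; apply: nD1.
    have : phi (~` D2) n -> phi D1 n by near: n; exact: D12.
    apply; have -> : phi (~` D2) n <-> ~ phi D2 n by near: n; exact: phiC.
    by [].
  split.
  - exists set0, set0; split; last by rewrite setCT.
      by apply: small_almost_empty; exists 0 => // n _ [].
    by apply: small_almost_empty; exists 0 => // n _ [].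
  - move=> A A' [D1 [D2 [s1 s2 AD]]] [D1' [D2' [s1' s2' AD']]].
    exists (D1 `|` D1'), (D2 `|` D2'); split; [exact: smallU|exact: smallU|].
    by rewrite setCI => n [/AD|/AD'] [];
      [left; left|right; left|left; right|right; right].
  - move=> A A' AA' [D1 [D2 [s1 s2 AD]]]; exists D1, D2; split => //.
    by move=> n nA'n; apply: AD => /AA'.
have [|w wF] := Nstar_extend FF.
  move=> A Aoo; exists (~` A), set0; split; last by left.
    by apply: small_almost_empty; apply: filterS Aoo => n An; apply.
  by apply: small_almost_empty; exists 0 => // n _ [].
have wsmall D K : ult w D -> (K = C \/ K = ~` C) -> ~ small K D.
  move=> wD KC sD; suff /(ultC w) : ult w (~` D) by apply.
  have s0 K' : small K' set0 by apply: small_almost_empty; exists 0 => // n _ [].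
  apply: wF; case: KC => KC; subst K; [exists D, set0|exists set0, D]; split => //.
    by rewrite setCK => n; left.
  by rewrite setCK => n; right.
have lft K : (K = C \/ K = ~` C) -> exists2 x, ult x (B `&` K) & psi x = w.
  move=> KC; apply: psi_preimage_in => D wD H; apply: (wsmall D K wD KC).
  by case: H => N _ H; exists N => // n /H nH Bn Kn Dn; apply: nH.
have [x /ultI[xB xC] xw] := lft C (or_introl erefl).
have [y /ultI[yB yC] yw] := lft (~` C) (or_intror erefl).
exists x, y; split => //; first by rewrite xw yw.
by move=> xy; move/(ultC y C): yC; apply; rewrite -xy.
Unshelve. all: by end_near.
Qed.

End Psi.

(** * Composition with a continuous map between compact spaces *)

Local Open Scope ring_scope.

Section SurjectiveComposition.
Context (R : realType) (K L : compactSpaceType) (psi : continuousType L K).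
Hypothesis psi_surj : forall y, exists x, psi x = y.
Local Notation T := (@comp_operator R K L psi).

Lemma comp_operator_isometry (f : contfun K R) : `|T f| = `|f|.
Proof.
apply/eqP; rewrite eq_le; apply/andP; split.
  by apply: sup_norm_le => [|x]; [exact: sup_norm_ge0|exact: (sup_norm_ge f)].
apply: sup_norm_le => [|y]; first exact: sup_norm_ge0.
by have [x <-] := psi_surj y; exact: (sup_norm_ge (T f)).
Qed.

(** A limit [g] of functions [f \o psi] is constant on the fibres of [psi], hence
    equals [g \o s \o psi] for any section [s]; and [g \o s] is continuous, even
    if [s] is not, as the uniform limit of the functions [f]. *)
Lemma comp_operator_closed_range : closed (range T).
Proof.
move=> g gcl; have near_g (e : R) : 0 < e ->
    exists f : contfun K R, forall x, `|g x - f (psi x)| < e.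
  move=> e0; have [_ [[f _ <-] gf]] := gcl _ (nbhsx_ballx g e e0).
  exists f => x; move: gf; rewrite -ball_normE /=; apply: le_lt_trans.
  exact: (sup_norm_ge (g - T f)).
have [s sK] := choice psi_surj.
have gs x : g x = g (s (psi x)).
  apply/eqP; rewrite -subr_eq0 -normr_le0; apply/ler_addgt0Pl => e e0.
  rewrite addr0; have [f fg] := near_g (e / 2) (divr_gt0 e0 (ltr0Sn _ 1)).
  rewrite (splitr e) -(subrKA (f (psi x))) (le_trans (ler_normD _ _)) // lerD // ?ltW //.
  by have := fg (s (psi x)); rewrite sK distrC.
have fc : continuous (g \o s).
  move=> y; apply/cvgrPdist_lt => e e0.
  have e4 : 0 < e / 2 / 2 by rewrite !divr_gt0.
  have e42 : e / 2 / 2 < e / 2 by rewrite [ltRHS]splitr ltrDl.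
  have [f fg] := near_g (e / 2 / 2) e4.
  have fgs z : `|g (s z) - f z| < e / 2 / 2 by have := fg (s z); rewrite sK.
  have /cvgrPdist_lt /(_ _ e4) := @contfun_continuous _ _ f y.
  apply: filterS => z fyz.
  rewrite /= -(subrKA (f y)) -[X in _ + X](subrKA (f z)).
  rewrite (le_lt_trans (ler_normD _ _)) // [ltRHS]splitr ltrD //.
    exact: lt_trans e42.
  rewrite (le_lt_trans (ler_normD _ _)) // [ltRHS]splitr ltrD //.
  by rewrite distrC.
exists (mkcontfun fc) => //; apply: contfunP => x.
by rewrite [RHS]gs.
Qed.

Lemma comp_operator_embedding : isomorphic_embedding T.
Proof.
have /choice[S SP] : forall g : contfun L R, exists f, forall h, T h = g -> f = h.
  move=> g; have [[h Th]|nh] := pselect (exists h, T h = g); last first.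
    by exists 0 => h Th; exfalso; apply: nh; exists h.
  exists h => h' Th'; apply: contfunP => y; have [x <-] := psi_surj y.
  by have := congr1 (fun k : contfun L R => k x) (etrans Th (esym Th')).
split.
- by exists 1 => f; rewrite comp_operator_isometry mul1r.
- exact: comp_operator_closed_range.
- have SK : cancel T S by move=> f; exact: SP.
  exists S; split => //; apply/subspace_continuousP => _ [f _ <-].
  apply/cvgrPdist_lt => e e0; near=> g.
  have [h _ hg] : range T g by near: g; exact: withinT.
  rewrite /from_subspace (SK f) (SP g h hg) -comp_operator_isometry.
  rewrite (_ : T (f - h) = T f - g); last by rewrite -hg -raddfB.
  near: g; apply: cvg_within; apply: filterS (nbhsx_ballx (T f) e e0) => g.
  by rewrite -ball_normE.
Unshelve. all: by end_near.
Qed.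

End SurjectiveComposition.

Section Evaluation.
Context (R : realType) (K : ptopologicalType).

Lemma open_borel (A : set K) : open A -> measurable (A : set (borel K)).
Proof. exact: sub_sigma_algebra. Qed.

Lemma closed_borel (A : set K) : closed A -> measurable (A : set (borel K)).
Proof.
move=> cA; rewrite -[A : set (borel K)]setCK; apply: measurableC.
by apply: open_borel; exact: closed_openC.
Qed.

Lemma continuous_borel (f : contfun K R) :
  measurable_fun [set: borel K] (f : borel K -> R).
Proof.
apply: (measurability _ (RGenOpens.measurableE R)).
move=> _ [_ [a [b ->] <-]]; rewrite setTI; apply: open_borel.
have /continuousP := @contfun_continuous _ _ f; apply; exact: interval_open.
Qed.

(** Evaluation at [z] is represented by the unit mass at [z], which is concentrated
    on every set that contains [z]. *)
Lemma concentrated_evaluation (phi : {linear contfun K R -> R^o}) z (G : set K) :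
  closed [set z] -> (forall f, phi f = f z) -> G z -> concentrated_on phi G.
Proof.
move=> z1 phiz Gz.
pose mu := @dirac _ (borel K) z R.
pose nu : {charge set (borel K) -> \bar R} := charge_of_finite_measure mu.
have nuE A : nu A = mu A by [].
have nuTN : hahn_decomposition nu setT set0.
  split; rewrite ?setUid ?setI0 ?setU0 //.
  by split => // A mA; rewrite subset0 => ->; rewrite nuE /mu dirac0.
have posE A : measurable A -> jordan_pos nuTN A = mu A.
  by move=> mA; rewrite jordan_posE cjordan_posE /crestr0 mem_set //= /crestr setIT.
have negE A : measurable A -> jordan_neg nuTN A = 0%E.
  move=> mA; rewrite jordan_negE cjordan_negE /crestr0 mem_set //= /crestr setI0.
  by rewrite indic0 oppr0.
have varE A : measurable A -> charge_variation nuTN A = mu A.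
  by move=> mA; rewrite /charge_variation /= posE // negE // adde0.
exists nu, setT, set0, nuTN; split.
- move=> A mA; rewrite varE //; apply/eqP; rewrite eq_le; apply/andP; split.
    have [Az|nAz] := pselect (A z).
      apply: ereal_sup_ubound; exists [set z].
        by split; [exact: closed_borel|exact: compact_set1|move=> _ ->].
      rewrite varE; last exact: closed_borel.
      by rewrite /mu !diracE !mem_set.
    rewrite /mu diracE memNset //; apply: ereal_sup_ubound; exists set0.
      by split => //; exact: compact0.
    by rewrite varE // /mu dirac0.
  apply: ub_ereal_sup => _ [B [mB _ BA] <-]; rewrite varE //.
  by apply: le_measure; rewrite ?inE.
- move=> f; rewrite phiz /charge_integral.
  rewrite (@eq_measure_integral _ _ _ _ mu (jordan_pos nuTN)); last first.
    by move=> A mA _; exact: posE.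
  rewrite (@eq_measure_integral _ _ _ _ mzero (jordan_neg nuTN)); last first.
    by move=> A mA _; exact: negE.
  rewrite integral_measure_zero sube0 integral_dirac //.
    by rewrite diracT mul1e.
  apply/measurable_EFinP. exact: continuous_borel f.
- exists (~` [set z]); split.
  + by apply: measurableC; exact: closed_borel.
  + rewrite varE; last by apply: measurableC; exact: closed_borel.
    by rewrite /mu diracE memNset //= => /(_ erefl).
  + by move=> x nGx /= xz; apply: nGx; rewrite xz.
Qed.

End Evaluation.

(** * The composition operator on the remainder *)

(** Both Jordan parts of a representing measure vanish on an open set that is
    disjoint from the set of concentration. *)
Lemma concentrated_indic_eq0 (R : realType) (K : ptopologicalType)
    (phi : {linear contfun K R -> R^o}) (F A : set K) (f : contfun K R) :
  concentrated_on phi F -> open A -> A `&` F = set0 ->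
  (forall x, f x = \1_A x) -> phi f = 0.
Proof.
move=> [nu [P [N [nuPN [_ phiE [D [mD varD FD]]]]]]] oA AF fA.
have AD : A `<=` D.
  by move=> x Ax; apply: FD => Fx; have : (A `&` F) x by []; rewrite AF.
have mA := @open_borel K A oA.
have : charge_variation nuPN A = 0%E.
  apply/eqP; rewrite eq_le measure_ge0 andbT -varD.
  by apply: le_measure; rewrite ?inE.
rewrite /charge_variation /= => /eqP.
rewrite padde_eq0 ?measure_ge0 // => /andP[/eqP posA /eqP negA].
apply/eqP; rewrite -eqe phiE /charge_integral.
have E (m : {measure set (borel K) -> \bar R}) :
    (\int[m]_(x in [set: borel K]) (f x)%:E = m A)%E.
  under eq_integral do rewrite fA.
  by rewrite integral_indic // setIT.
rewrite !E; apply/eqP; change (jordan_pos nuPN A - jordan_neg nuPN A = 0)%E.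
by rewrite posA negA sube0.
Qed.

Section NstarOperator.
Context (R : realType).

Definition cst1 (K : topologicalType) : contfun K R :=
  mkcontfun (@cst_continuous K R 1).

Lemma extend_cst1 A x : extend_by_zero (cst1 (star A)) x = \1_(star A) x.
Proof.
rewrite -[LHS]/(zero_ext (cst1 (star A)) x) /zero_ext indicE.
by have [xA|xA] := boolP (x \in star A); [rewrite insubT|rewrite insubN].
Qed.

Lemma extend_restrict A (f : contfun Nstar R) x : x \in star A ->
  extend_by_zero (restrict_to A f) x = f x.
Proof.
by move=> xA; rewrite -[LHS]/(zero_ext (restrict_to A f) x) /zero_ext insubT.
Qed.

Lemma closed_point (z : Nstar) : closed [set z].
Proof.
rewrite -[[set z]]setCK; apply: open_closedC; rewrite openE => x /= xz.
have [A xA zA] : exists2 A, ult x A & ~ ult z A.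
  apply: contrapT => H; apply: xz; apply: ult_inj => A xA.
  by apply: contrapT => zA; apply: H; exists A.
by apply: filterS (star_nbhs xA) => y /in_star yA yz; apply: zA; rewrite -yz.
Qed.

(** Otherwise the indicator of a clopen neighbourhood of [z] that misses [F] would
    have value one at [z] and integral zero. *)
Lemma concentrated_closure (phi : {linear contfun Nstar R -> R^o}) z F :
  (forall f, phi f = f z) -> concentrated_on phi F -> closure F z.
Proof.
move=> phiz phiF; apply: contrapT => nFz.
have [|A zA AF] := @star_base (~` closure F) z _ nFz.
  by apply: closed_openC; exact: closed_closure.
have [oA _] := star_clopen A.
have AF0 : star A `&` F = set0.
  by rewrite -subset0 => x [/AF + Fx]; apply; exact: subset_closure.
have : extend_by_zero (cst1 (star A)) z = 0.
  apply: etrans (esym (phiz _)) _.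
  exact: concentrated_indic_eq0 phiF oA AF0 (@extend_cst1 A).
rewrite extend_cst1 indicE mem_set; last exact/in_star.
by move/eqP; rewrite oner_eq0.
Qed.

Section Operator.
Context (psi : continuousType Nstar Nstar).
Local Notation T := (@comp_operator R Nstar Nstar psi).

Lemma comp_everywhere_present : everywhere_present T.
Proof.
move=> B /infinite_almost_empty /star_nonempty[x xB]; exists (cst1 Nstar).
apply/eqP => H.
have xS : x \in star B by apply/mem_set/in_star.
have := congr1 (fun h : contfun (star B) R => h (SigSub xS)) H.
by move/eqP; rewrite oner_eq0.
Qed.

Lemma comp_no_fountains :
  (forall F, nowhere_dense F -> nowhere_dense (psi @^-1` F)) -> no_fountains T.
Proof.
move=> psiF F F0; have cF0 : nowhere_dense (closure F).
  by rewrite /nowhere_dense -(iffLR (closure_id _) (@closed_closure _ F)).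
have := psiF _ cF0; rewrite /nowhere_dense -!subset0; apply: subset_trans.
apply: interiorS; apply: closureS => y [_ yF].
exact: concentrated_closure yF.
Qed.

Lemma comp_no_funnels :
  (forall F, nowhere_dense F -> nowhere_dense (psi @` F)) -> no_funnels T.
Proof.
move=> psiF F F0; exists (psi @` F); first exact: psiF.
move=> y Fy; apply: (@concentrated_evaluation _ _ _ (psi y)) => //.
  exact: closed_point.
Qed.

(** Testing the identity [T f = r * (f \o h)] on the constant one shows that [psi]
    maps the clopen set of [B] into that of [A] and that [r = 1]; testing it on
    indicators shows that [psi] is [h] there, which is injective. *)
Lemma comp_nowhere_canonizable :
  (forall B, ~ almost_empty B -> exists x y,
     [/\ ult x B, ult y B, psi x = psi y & x <> y]) ->
  nowhere_canonizable_along_homeo T.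
Proof.
move=> psi_ninj [A [B [h [r [_ Binf [_ [g [_ hK _]]] r0 Tloc]]]]].
have [x [y [xB yB psixy xy]]] := psi_ninj B (infinite_almost_empty Binf).
have xS : x \in star B by apply/mem_set/in_star.
have yS : y \in star B by apply/mem_set/in_star.
have loc f z (zS : z \in star B) :
    extend_by_zero f (psi z) = r * f (h (SigSub zS)) by exact: (Tloc f (SigSub zS)).
have psiA z (zS : z \in star B) : psi z \in star A.
  apply: contraT => nA; have := loc (cst1 _) z zS.
  rewrite extend_cst1 indicE (negbTE nA) => /eqP.
  by rewrite eq_sym mulf_eq0 oner_eq0 (negbTE r0).
have r1 : r = 1.
  have := loc (cst1 _) x xS; rewrite extend_cst1 indicE (psiA _ xS).
  by move=> e; apply: etrans (esym (mulr1 r)) _; exact: esym e.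
have hpsi z (zS : z \in star B) : \val (h (SigSub zS)) = psi z.
  apply/esym/ult_inj => D zD; apply: contrapT => nD.
  have := loc (restrict_to A (extend_by_zero (cst1 (star D)))) z zS.
  rewrite r1 mul1r extend_restrict; last exact: psiA.
  rewrite -[RHS]/(extend_by_zero (cst1 (star D)) (\val (h (SigSub zS)))).
  rewrite !extend_cst1 !indicE mem_set; last exact/in_star.
  rewrite memNset; last by move/in_star.
  by move/eqP; rewrite oner_eq0.
apply: xy; have : h (SigSub xS) = h (SigSub yS).
  by apply: val_inj; rewrite !hpsi.
by move/(can_inj hK)/(congr1 val).
Qed.

End Operator.
End NstarOperator.

Theorem theorem6p10 (R : realType) : CH ->
  exists psi : continuousType Nstar Nstar,
    [/\ quasi_open psi,
        (forall y : Nstar, exists x : Nstar, psi x = y),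
        (forall F : set Nstar, nowhere_dense F -> nowhere_dense (psi @` F)) &
        (forall U : set Nstar, clopen U -> U !=set0 ->
           ~ set_bij U (psi @` U) psi)] /\
    let T : {linear contfun Nstar R -> contfun Nstar R} :=
      @comp_operator R Nstar Nstar psi in
    [/\ everywhere_present T,
        isomorphic_embedding T,
        no_fountains T,
        no_funnels T &
        nowhere_canonizable_along_homeo T].
Proof.
move=> /dense_embedding_exists[phi phiP].
have [f fP] := psi_exists phiP.
have fsurj := psi_surj phiP fP.
have fimage := psi_image_nowhere_dense phiP fP.
have fpreimage := psi_preimage_nowhere_dense phiP fP.
have fninj := psi_not_injective phiP fP.
have fqo := psi_quasi_open phiP fP.
exists (mkcts (psi_continuous fP)); split; last split.
- split; [exact fqo|exact fsurj|exact fimage|].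
  move=> U [oU _] [u Uu] [_ finj _].
  have [B uB BU] := star_base oU Uu.
  have [x [y [xB yB fxy]]] := fninj B (ult_almost_empty uB).
  by apply; apply: finj => //; apply/mem_set/BU/in_star.
- exact: comp_everywhere_present.
- by apply: comp_operator_embedding; exact fsurj.
- by apply: comp_no_fountains; exact fpreimage.
- by apply: comp_no_funnels; exact fimage.
- by apply: comp_nowhere_canonizable; exact fninj.
Qed.
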